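(* Let $A^0=(A^0(t))_{t\ge0}$ be a stochastic process with almost surely continuous paths $[0,\infty)\to\mathbb R$ and $A^0(0)=0$. Let $\{W^n\}_{n\ge1}$ be standard Brownian motions and $\{\mathcal E^n\}_{n\ge1}$ exponential random variables with common parameter $c>0$, with $A^0$, all $W^n$ and all $\mathcal E^n$ mutually independent. Define recursively $$A^n=\mathcal Q\Big(A^{n-1},\;W^n_\cdot+c\,\cdot-\sum_{i=1}^n\mathcal E^i\Big),\qquad n\ge1.$$ Then, as $n\to\infty$, the processes $A^n+\sum_{i=1}^n\mathcal E^i$ converge weakly (in the space of continuous functions on $[0,\infty)$ with the topology of uniform convergence on compact sets) to a standard Brownian motion.
   Context: For functions $f,g:[0,\infty)\to\mathbb R$ that are càdlàg with $f(0)\ge g(0)$, define $$L_f(g)(t):=g(t)+\inf_{0\le s\le t}\big\{(f(s)-g(s))\wedge 0\big\},$$ and the queueing operator $\mathcal Q(f,g):=L_f(g)$ ($f$ = arrival process, $g$ = service process, $\mathcal Q(f,g)$ = departure process). Note $A^{n-1}(0)=-\sum_{i=1}^{n-1}\mathcal E^i\ge -\sum_{i=1}^{n}\mathcal E^i$, so each $\mathcal Q$ above is well defined. *)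

(* Defs.v *)
From HB Require Import structures.
From mathcomp Require Import all_boot all_order all_algebra.
From mathcomp Require Import all_classical all_reals all_analysis.
From mathcomp Require Import normal_distribution exponential_distribution.

Set Implicit Arguments.
Unset Strict Implicit.
Unset Printing Implicit Defensive.

Import Order.TTheory GRing.Theory Num.Theory.
Import numFieldNormedType.Exports.
Local Open Scope classical_set_scope.
Local Open Scope ring_scope.

Section defs.
Context {R : realType}.

(* Time is [0, +oo); real-valued paths are modelled as functions R -> R,
   only their restriction to [0, +oo) matters. *)

Definition Lop (f g : R -> R) (t : R) : R :=
  g t + inf [set Num.min (f s - g s) 0 | s in `[0, t]].

Definition Qop (f g : R -> R) : R -> R := Lop f g.

(** Partial sums: Esum E n = E^1 + ... + E^n, where E i (0-indexed) plays
    the role of the paper's E^{i+1}. *)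
Definition Esum {T : Type} (E : nat -> T -> R) (n : nat) (w : T) : R :=
  \sum_(i < n) E i w.

(** The tandem recursion:  A 0 = A0,
    A (n+1) = Q(A n, W^{n+1}_t + c t - sum_{i=1}^{n+1} E^i),
    where W i / E i (0-indexed) are the paper's W^{i+1} / E^{i+1}. *)
Fixpoint Aproc {T : Type} (c : R) (A0 : T -> R -> R) (W : nat -> T -> R -> R)
    (E : nat -> T -> R) (n : nat) (w : T) : R -> R :=
  match n with
  | 0 => A0 w
  | m.+1 => Qop (Aproc c A0 W E m w)
                (fun t => W m w t + c * t - Esum E m.+1 w)
  end.

Section prob.
Context {d : measure_display} {T : measurableType d} (P : probability T R).

Definition cont_path (g : R -> R) : Prop := {within `[0, +oo[, continuous g}.

Definition is_process (X : T -> R -> R) : Prop :=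
  forall t, 0 <= t -> measurable_fun setT (fun w => X w t).

Definition std_BM (X : T -> R -> R) : Prop :=
  [/\ is_process X,
      {ae P, forall w, cont_path (X w) /\ X w 0 = 0} &
      forall (ts : seq R) (B : seq (set R)),
        size B = size ts ->
        path <%R 0 ts ->
        (forall b, b \in B -> measurable b) ->
        P (\bigcap_(i in [set i | (i < size ts)%N])
              [set w | X w (nth 0 ts i) - X w (nth 0 (0 :: ts) i)
                       \in nth set0 B i])
        = \big[*%E/1%E]_(i < size ts)
            normal_prob 0 (Num.sqrt (nth 0 ts i - nth 0 (0 :: ts) i))
                        (nth set0 B i)].

Definition exp_rv (c : R) (Y : T -> R) : Prop :=
  measurable_fun setT Y /\
  forall B : set R, measurable B -> P (Y @^-1` B) = exponential_prob c B.

Definition sigma_proc (X : T -> R -> R) : set (set T) :=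
  <<s [set (fun w => X w t) @^-1` B | t in `[0, +oo[ & B in @measurable _ R] >>.

Definition sigma_rv (Y : T -> R) : set (set T) :=
  <<s [set Y @^-1` B | B in @measurable _ R] >>.

Definition mutually_independent {I : eqType} (F : I -> set (set T)) : Prop :=
  forall (J : seq I) (A : I -> set T),
    uniq J -> (forall j, j \in J -> F j (A j)) ->
    P (\bigcap_(j in [set j | j \in J]) A j) = \big[*%E/1%E]_(j <- J) P (A j).

Definition Epath (f : (R -> R) -> R) (X : T -> R -> R) : \bar R :=
  (\int[P]_w (f (X w))%:E)%E.

End prob.

(** Bounded functionals on C([0,+oo)) that are continuous for the topology of
    uniform convergence on compacts (this topology is metrizable, so
    continuity is sequential continuity). *)
Definition bounded_cont_functional (f : (R -> R) -> R) : Prop :=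
  (exists M : R, forall g, `|f g| <= M) /\
  forall (gs : nat -> R -> R) (g : R -> R),
    (forall k, cont_path (gs k)) -> cont_path g ->
    (forall Tm : R, 0 <= Tm ->
       (fun k => sup [set `|gs k t - g t| | t in `[0, Tm]]) @ \oo --> (0 : R)) ->
    (fun k => f (gs k)) @ \oo --> f g.

End defs.

(* Main.v *)
From HB Require Import structures.
Require Import Defs.
From mathcomp Require Import all_boot all_order all_algebra.
From mathcomp Require Import all_classical all_reals all_analysis.
From mathcomp Require Import normal_distribution exponential_distribution.
From mathcomp Require Import measurable_realfun.
From mathcomp Require Import ring lra.

(** Adding [E^1 + ... + E^n] back, the process becomes [X^n] with
    [X^(n+1)(t) = W(t) + c t + inf_(s <= t) min(X^n(s) - W(s) - c s + E, 0)].

    Brownian Burke theorem: if [X^n] is a Brownian motion, so is [X^(n+1)].  On a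
    grid of mesh [h], replace the reflection of the queue length [q] by a
    rejection rule: with arrival and service increments [b] and [w], move to
    [q + b - w - c h] and output [w + c h] if this is nonnegative; otherwise
    keep [q] and output [b].  This map sends [Exp(c) x N(0,h) x N(0,h)] exactly to
    [Exp(c) x N(0,h)], so the grid increments of all layers are exactly
    Gaussian; pathwise the rule differs from the reflection by at most a modulus
    of continuity, so letting [h] tend to 0 gives the theorem.

    Coupling: start one system from [X^1], another from the Brownian motion
    [W^1], and use the same [W^i], [E^i], [i >= 2], in both.  Both are minima of a
    term that depends on the starting path and of a common term that is at most
    [W^n(t) + c t - S_n], where [S_n] is the sum of the [E^i].  Burke's theorem
    with rate [2 c] and variables [E^i / 2] bounds the first term below by
    [- S_n / 2 - O(1)].  As [S_n] tends to infinity, the two systems agree on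
    [[0, k]] with probability tending to 1.  Bounded continuous functionals are
    then approximated from below by Lipschitz ones that only depend on
    [[0, k]]. *)

Set Implicit Arguments.
Unset Strict Implicit.
Unset Printing Implicit Defensive.
Import Order.TTheory GRing.Theory Num.Theory.
Import numFieldNormedType.Exports.
Local Open Scope classical_set_scope.
Local Open Scope ring_scope.

(** * Paths and the queueing recursion *)

(** A functional [f] is tested on whole paths and carries no measurability, while the data are known
    through increments only. Hence the detour through grids and rounding: at each mesh a path
    becomes a natural number, the law of that number is fixed by the grid law, and both the
    measurability of [f] along a layer and the equality of expectations pass to the limit pointwise.
    On the grid, reflection would put an atom at [0] in the law of the queue; rejection keeps the
    queue exactly exponential, so no error accumulates in the laws.

    [W^1] is chosen as second starting path because it already lives on the same space and is
    independent of the later layers. Rate [2 c] is one choice of a rate [a > c]: scaling by [c / a]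
    turns rate [c] into rate [a], so the part depending on the start stays above the common part by
    the fraction [1 - c / a] of [S_n], up to terms bounded in probability; [a = 2 c] makes both
    shares [S_n / 2]. Approximation of [f] is one-sided; the other inequality comes from [- f]. *)

Section paths.
Context {R : realType}.
Implicit Types (x y w m : R -> R) (c e t s Tm : R).

Definition lucont x := forall Tm e, 0 < e -> exists2 d, 0 < d &
  forall s t, 0 <= s <= Tm -> 0 <= t <= Tm -> `|s - t| <= d -> `|x s - x t| <= e.

(** Heine-Cantor, through the near-covering form of compactness: near each [s0] the property [P d]
    holds for all small [d], so one [d] serves all of [[0, Tm]]. From here on [lucont] stands for
    continuity, since the estimates need a modulus. *)
Lemma cont_path_lucont x : cont_path x -> lucont x.
Proof.
move=> /subspace_continuousP cx Tm e e0.
have e20 : 0 < e / 2 by rewrite divr_gt0.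
pose P (d s : R) := 0 <= s <= Tm ->
  forall t, 0 <= t <= Tm -> `|s - t| <= d -> `|x s - x t| <= e.
have : \forall d \near (0:R)^'+, `[0, Tm]%classic `<=` P d.
  apply: (proj1 (compact_near_coveringP _) (@segment_compact R 0 Tm)).
  move=> s0; rewrite /= in_itv /= => /andP[s00 s0T].
  have /cx : `[0, +oo[%classic s0 by rewrite /= in_itv /= s00.
  move=> /cvgrPdist_le /(_ _ e20) /nbhs_ballP[r /= r0 br].
  have br' u : 0 <= u -> `|s0 - u| < r -> `|x s0 - x u| <= e / 2.
    by move=> u0 ur; apply: br => //; rewrite in_itv /= u0.
  have r20 : 0 < r / 2 by rewrite divr_gt0.
  exists (ball s0 (r / 2), [set d | d < r / 2]).
    split; first exact: nbhsx_ballx.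
    exact: nbhs_right_lt.
  move=> [s d] /= [sr dr] /andP[s_ge0 sT] t /andP[t0 tT] st.
  have h1 : `|x s0 - x s| <= e / 2.
    by apply: br' => //; apply: lt_trans sr _; rewrite gtr_pMr // invf_lt1 // ltr1n.
  have h2 : `|x s0 - x t| <= e / 2.
    apply: br' => //; rewrite -(subrKA s) (splitr r).
    by apply: le_lt_trans (ler_normD _ _) _; apply: ltrD => //; apply: le_lt_trans dr.
  rewrite -(subrKA (x s0)) (splitr e).
  by apply: le_trans (ler_normD _ _) _; rewrite lerD // distrC.
move=> hd; have [d [d0 {}hd]] := filter_ex (filterI (nbhs_right_gt (0 : R)) hd).
by exists d => // s t s0T; apply: hd => //=.
Qed.

Lemma lucont_cont_path x : lucont x -> cont_path x.
Proof.
move=> ux; apply/subspace_continuousP => s /=; rewrite in_itv /= andbT => s0.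
apply/cvgrPdist_le => e e0.
have [d d0 hd] := ux (s + 1) e e0.
have d10 : 0 < Num.min d 1 by rewrite lt_min d0 ltr01.
apply/nbhs_ballP; exists (Num.min d 1) => //= t.
rewrite /ball /= lt_min => /andP[std st1]; rewrite in_itv /= andbT => t0.
apply: hd; rewrite ?s0 ?t0 ?lerDl ?ler01 ?ltW //=.
by move: st1; rewrite ltr_distl; lra.
Qed.

(** The path moves by at most [1] over a time step of length [d], so its displacement is at most the
    number of such steps needed to reach [Tm]. *)
Lemma lucont_bounded x Tm : lucont x -> exists2 K, 0 < K & forall t, 0 <= t <= Tm -> `|x t| <= K.
Proof.
move=> /(_ Tm 1 ltr01)[d d0 hd].
have hk (k : nat) t : 0 <= t <= Tm -> t <= k%:R * d -> `|x t - x 0| <= k%:R.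
  elim: k t => [|k IH] t tT tk.
    have -> : t = 0 by apply/eqP; rewrite eq_le (andP tT).1 andbT; rewrite mul0r in tk.
    by rewrite subrr normr0.
  have [td|td] := leP t d.
    apply: le_trans (_ : 1 <= _); last by rewrite ler1n.
    apply: hd => //; first by rewrite lexx; case/andP: tT => a b; exact: le_trans b.
    by rewrite subr0 ger0_norm // (andP tT).1.
  have sT : 0 <= t - d <= Tm by move: tT; lra.
  rewrite -(subrKA (x (t - d))) mulrS.
  apply: le_trans (ler_normD _ _) _; apply: lerD.
    by apply: hd => //; rewrite subKr gtr0_norm.
  by apply: IH => //; move: tk; rewrite mulrS; lra.
exists (`|x 0| + (Num.truncn (Tm / d)).+1%:R) => [|t tT].
  by rewrite ltr_wpDl // ltr0n.
have {}hk := hk (Num.truncn (Tm / d)).+1 t tT.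
have {hk} : `|x t - x 0| <= (Num.truncn (Tm / d)).+1%:R.
  apply: hk; rewrite -ler_pdivrMr //.
  apply: le_trans (ltW (truncnS_gt _)).
  by rewrite ler_pM2r ?invr_gt0 //; case/andP: tT.
by move=> h; rewrite -[x t](subrK (x 0)) addrC; apply: le_trans (ler_normD _ _) _; rewrite lerD2l.
Qed.

Definition run_inf m t := inf [set m s | s in `[0, t]].

Lemma rinf_ge m t (r : R) : 0 <= t -> (forall s, 0 <= s <= t -> r <= m s) -> r <= run_inf m t.
Proof.
move=> t0 h; apply: lb_le_inf.
  by exists (m 0); exists 0 => //=; rewrite in_itv /= lexx.
by move=> _ [s /= + <-]; rewrite in_itv /=; exact: h.
Qed.

Lemma rinf_le m t s : lucont m -> 0 <= s <= t -> run_inf m t <= m s.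
Proof.
move=> um st; apply: ge_inf; last by exists s => //=; rewrite in_itv.
have [K _ hK] := lucont_bounded t um.
exists (- K) => _ [u /= + <-]; rewrite in_itv /= => /hK.
by rewrite ler_norml => /andP[].
Qed.

Lemma eq_rinf m m' t : (forall s, 0 <= s <= t -> m s = m' s) -> run_inf m t = run_inf m' t.
Proof.
move=> h; rewrite /run_inf; congr inf; apply/seteqP.
split=> _ [s /= st <-]; exists s => //; move: st; rewrite in_itv /= => /h; by move=> ->.
Qed.

(** A running infimum inherits the modulus of [m]: between [s] and [t] it can only drop to values of
    [m] at points within [d] of [s], and these are at least [m s - e]. *)
Lemma lucont_rinf m : lucont m -> lucont (run_inf m).
Proof.
move=> um Tm e e0; have [d d0 hd] := um Tm e e0; exists d => //.
have main s t : 0 <= s <= t -> t <= Tm -> `|s - t| <= d -> `|run_inf m s - run_inf m t| <= e.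
  move=> /andP[s0 st] tT std.
  have t0 := le_trans s0 st.
  have h1 : run_inf m t <= run_inf m s.
    apply: rinf_ge => // u /andP[u0 us]; apply: rinf_le => //.
    by rewrite u0 (le_trans us).
  rewrite ger0_norm ?subr_ge0 // lerBlDl -lerBlDr.
  apply: rinf_ge => // u /andP[u0 ut].
  have [us|us] := leP u s.
    rewrite lerBlDl; apply: le_trans (_ : m u <= _); last by rewrite lerDr ltW.
    by apply: rinf_le => //; rewrite u0.
  have : `|m s - m u| <= e.
    apply: hd; [by rewrite s0 (le_trans st)|by rewrite u0 (le_trans ut)|].
    by move: std; rewrite !ler_norml; lra.
  rewrite ler_distl => /andP[_ h2].
  by rewrite lerBlDl addrC; apply: le_trans h2; apply: rinf_le => //; rewrite s0 lexx.
move=> s t /andP[s0 sT] /andP[t0 tT] std.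
have [st|/ltW ts] := leP s t; first by apply: main => //; rewrite s0.
by rewrite distrC; apply: main => //; rewrite ?t0 // distrC.
Qed.

Lemma lucontD x y : lucont x -> lucont y -> lucont (fun t => x t + y t).
Proof.
move=> ux uy Tm e e0; have e2 : 0 < e / 2 by rewrite divr_gt0.
have [d1 d10 h1] := ux Tm _ e2; have [d2 d20 h2] := uy Tm _ e2.
exists (Num.min d1 d2); first by rewrite lt_min d10.
move=> s t sT tT; rewrite le_min => /andP[/(h1 _ _ sT tT) {}h1 /(h2 _ _ sT tT) {}h2].
rewrite opprD addrACA (splitr e).
by apply: le_trans (ler_normD _ _) _; exact: lerD.
Qed.

Lemma lucont_lip x (K : R) : (forall s t, 0 <= s -> 0 <= t -> `|x s - x t| <= K * `|s - t|) -> lucont x.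
Proof.
move=> h Tm e e0; exists (e / (`|K| + 1)); first by rewrite divr_gt0 // ltr_wpDl.
move=> s t /andP[s0 _] /andP[t0 _] st.
apply: le_trans (h _ _ s0 t0) _.
have k0 : 0 < `|K| + 1 by rewrite ltr_wpDl.
apply: le_trans (_ : (`|K| + 1) * `|s - t| <= _).
  by apply: ler_wpM2r => //; apply: le_trans (ler_norm _) _; rewrite lerDl.
by rewrite mulrC -ler_pdivlMr.
Qed.

Lemma lucontZ x (K : R) : lucont x -> lucont (fun t => K * x t).
Proof.
move=> ux Tm e e0; have k0 : 0 < `|K| + 1 by rewrite ltr_wpDl.
have [d d0 hd] := ux Tm (e / (`|K| + 1)) (divr_gt0 e0 k0); exists d => // s t sT tT st.
rewrite -mulrBr normrM; apply: le_trans (_ : (`|K| + 1) * `|x s - x t| <= _).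
  by rewrite ler_wpM2r // lerDl.
by rewrite mulrC -ler_pdivlMr // hd.
Qed.

Lemma lucontN x : lucont x -> lucont (fun t => - x t).
Proof. by move=> /(@lucontZ _ (-1)); under eq_fun do rewrite mulN1r. Qed.

Lemma lucont_cst (a : R) : lucont (fun=> a).
Proof. by apply: (@lucont_lip _ 0) => s t _ _; rewrite subrr normr0 mul0r. Qed.

Lemma lucont_id : lucont id.
Proof. by apply: (@lucont_lip _ 1) => s t _ _; rewrite mul1r. Qed.

Lemma lucont_min x (r : R) : lucont x -> lucont (fun t => Num.min (x t) r).
Proof.
move=> ux Tm e e0; have [d d0 hd] := ux Tm e e0; exists d => // s t sT tT st.
have := hd _ _ sT tT st; rewrite !ler_norml !minEle.
by case: (leP (x s) r) => ?; case: (leP (x t) r) => ?; move: e0; lra.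
Qed.

Definition departure c x w e t := w t + c * t + run_inf (fun s => Num.min (x s - w s - c * s + e) 0) t.

Lemma lucont_departure_in c x w e : lucont x -> lucont w -> lucont (fun s => Num.min (x s - w s - c * s + e) 0).
Proof.
move=> ux uw; apply: lucont_min; apply: lucontD; last exact: lucont_cst.
apply: lucontD; first by apply: lucontD => //; exact: lucontN.
by apply: lucontN; apply: lucontZ; exact: lucont_id.
Qed.

Lemma lucont_departure c x w e : lucont x -> lucont w -> lucont (departure c x w e).
Proof.
move=> ux uw; apply: lucontD; last by apply: lucont_rinf; exact: lucont_departure_in.
by apply: lucontD => //; apply: lucontZ; exact: lucont_id.
Qed.

Lemma departure0 c x w e : x 0 = 0 -> w 0 = 0 -> 0 <= e -> departure c x w e 0 = 0.
Proof.
move=> x0 w0 e0; rewrite /departure w0 mulr0 !add0r.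
rewrite (@eq_rinf _ (fun=> 0)) => [|s].
  rewrite /run_inf (_ : [set _ | _ in _] = [set 0]) ?inf1 //.
  apply/seteqP; split=> [_ [s _ <-]//|_ ->]; exists 0 => //=.
  by rewrite in_itv /= lexx.
by rewrite -eq_le => /eqP <-; rewrite x0 w0 mulr0 !subr0 add0r; apply/min_idPr.
Qed.

Fixpoint layer c x (w : nat -> R -> R) (e : nat -> R) n : R -> R :=
  if n is n.+1 then departure c (layer c x w e n) (w n) (e n) else x.

(** [layer] adds the last queue; the coupling has to split off the first one, whose departures
    become the new starting path. *)
Lemma layer_front c x (w : nat -> R -> R) (e : nat -> R) n :
  layer c x w e n.+1 = layer c (departure c x (w 0%N) (e 0%N)) (fun k => w k.+1) (fun k => e k.+1) n.
Proof. by elim: n => //= n IH; rewrite -IH. Qed.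

Lemma lucont_layer c x (w : nat -> R -> R) (e : nat -> R) n : lucont x -> (forall k, lucont (w k)) -> lucont (layer c x w e n).
Proof. by move=> ux uw; elim: n => //= n IH; exact: lucont_departure. Qed.

Lemma layer0 c x (w : nat -> R -> R) (e : nat -> R) n : x 0 = 0 -> (forall k, w k 0 = 0) -> (forall k, 0 <= e k) ->
  layer c x w e n 0 = 0.
Proof. by move=> x0 w0 e0; elim: n => //= n IH; exact: departure0. Qed.

(** Adding the partial sums back cancels, inside the infimum, everything but the newest variable
    [E n]; hence one [e n] per queue in [layer]. *)
Lemma Aproc_layer {T : Type} c (A0 : T -> R -> R) W (E : nat -> T -> R) n (w : T) t :
  Aproc c A0 W E n w t + Esum E n w = layer c (A0 w) (W ^~ w) (E ^~ w) n t.
Proof.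
elim: n t => [|n IH] t; first by rewrite /Esum big_ord0 addr0.
rewrite /= /Qop /Lop /departure {1 3}/Esum big_ord_recr /= -/(Esum E n w).
under eq_imagel => s _.
  rewrite (_ : Aproc c A0 W E n w s - (W n w s + c * s - Esum E n.+1 w) =
    layer c (A0 w) (W^~ w) (E^~ w) n s - W n w s - c * s + E n w); last first.
    by rewrite -IH /Esum big_ord_recr /=; ring.
  over.
by rewrite /run_inf; ring.
Qed.

Definition lucvg (xs : nat -> R -> R) x := forall Tm e, 0 < e ->
  exists N, forall k, (N <= k)%N -> forall t, 0 <= t <= Tm -> `|xs k t - x t| <= e.

Lemma bcf_cvg f xs x : bounded_cont_functional f -> (forall k, lucont (xs k)) -> lucont x ->
  lucvg xs x -> f (xs k) @[k --> \oo] --> f x.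
Proof.
move=> [_ fc] uxs ux h; apply: fc.
- by move=> k; exact: lucont_cont_path.
- exact: lucont_cont_path.
move=> Tm Tm0; apply/cvgrPdist_le => e e0.
have [N hN] := h Tm e e0; exists N => // k /= /hN {}hN.
have S0 : [set `|xs k t - x t| | t in `[0, Tm]] `|xs k 0 - x 0|.
  by exists 0 => //=; rewrite in_itv /= lexx.
have Se : ubound [set `|xs k t - x t| | t in `[0, Tm]] e.
  by move=> _ [t /= + <-]; rewrite in_itv /=; exact: hN.
rewrite sub0r normrN ger0_norm; first by apply: ge_sup Se; exists `|xs k 0 - x 0|.
by apply: le_trans (normr_ge0 _) (ub_le_sup _ S0); exists e.
Qed.

End paths.

(** * The recursion on a grid *)

Section discrete.
Context {R : realType}.
Implicit Types (c h q e s t Tm : R) (b w : nat -> R) (x : R -> R).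

(* A step that would make the queue length negative is cancelled; the whole
   arrival increment then goes through to the departures. *)
Definition qstep c h q (b w : R) := if 0 <= q + b - w - c * h then q + b - w - c * h else q.
Definition dstep c h q (b w : R) := if 0 <= q + b - w - c * h then w + c * h else b.

Fixpoint qrec c h q b w j :=
  if j is j.+1 then qstep c h (qrec c h q b w j) (b j) (w j) else q.

Definition dep c h b w q j := dstep c h (qrec c h q b w j) (b j) (w j).

Fixpoint dlayer c h b (w : nat -> nat -> R) (e : nat -> R) n :=
  if n is n.+1 then dep c h (dlayer c h b w e n) (w n) (e n) else b.

(** Invariance is proved from the input side: the departures of the first queue are the Gaussian
    input of the rest of the tandem. *)
Lemma dlayer_front c h b (w : nat -> nat -> R) (e : nat -> R) n :
  dlayer c h b w e n.+1 =
  dlayer c h (dep c h b (w 0%N) (e 0%N)) (fun k => w k.+1) (fun k => e k.+1) n.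
Proof. by elim: n => //= n IH; rewrite -IH. Qed.

Lemma qrec_front c h q b w j :
  qrec c h q b w j.+1 = qrec c h (qstep c h q (b 0%N) (w 0%N)) (fun k => b k.+1) (fun k => w k.+1) j.
Proof. by elim: j => //= j IH; rewrite -IH. Qed.

Lemma dep_front c h q b w j :
  dep c h b w q j.+1 =
  dep c h (fun k => b k.+1) (fun k => w k.+1) (qstep c h q (b 0%N) (w 0%N)) j.
Proof. by rewrite /dep qrec_front. Qed.

Definition csum b k := \sum_(j < k) b j.

Lemma csumS b k : csum b k.+1 = csum b k + b k.
Proof. by rewrite /csum big_ord_recr. Qed.

Definition incr h x j := x (j.+1%:R * h) - x (j%:R * h).

Lemma csum_incr h x k : csum (incr h x) k = x (k%:R * h) - x 0.
Proof.
elim: k => [|k IH]; first by rewrite /csum big_ord0 mul0r subrr.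
by rewrite csumS IH /incr; ring.
Qed.

(** Both branches of the rule conserve mass: the new queue length plus the departure equals the old
    length plus the arrival. *)
Lemma csum_dep c h b w q k : csum (dep c h b w q) k = csum b k + q - qrec c h q b w k.
Proof.
elim: k => [|k IH]; first by rewrite /csum !big_ord0 add0r subrr.
by rewrite !csumS IH /= /dep /dstep /qstep; case: ifP => _; ring.
Qed.

Lemma qrec_ge0 c h b w q k : 0 <= q -> 0 <= qrec c h q b w k.
Proof. by move=> q0; elim: k => //= k IH; rewrite /qstep; case: ifP. Qed.

Lemma grid_near h s (k : nat) : 0 < h -> 0 <= s <= k%:R * h ->
  exists2 j, (j <= k)%N & 0 <= s - j%:R * h <= h.
Proof.
move=> h0 /andP[s0 sk]; have sh0 : 0 <= s / h by rewrite divr_ge0 // ltW.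
have /andP[t1 t2] := truncn_itv sh0; exists (Num.truncn (s / h)).
  by rewrite -(ler_nat R); apply: le_trans t1 _; rewrite ler_pdivrMr.
move: t1 t2; rewrite ler_pdivlMr // ltr_pdivrMr // mulrSr mulrDl mul1r; lra.
Qed.

(** The discrete queue is [yd - I], with [yd] the free process on the grid and [I] nonincreasing
    from [0], so [I] imitates the running infimum of [min(y, 0)]. It lies below every earlier
    [yd j], and overshoots by at most one increment of [yd], because a step is cancelled only when
    [q] is smaller than the drop. Here [eta] is the error of the input and [eta'] the modulus of the
    free process over one mesh. *)
Lemma dep_close c h b x (w : R -> R) e Tm (eta eta' : R) :
  0 < h -> lucont x -> lucont w -> w 0 = 0 -> 0 <= e -> 0 <= eta -> 0 <= eta' ->
  (forall k, k%:R * h <= Tm -> `|csum b k - x (k%:R * h)| <= eta) ->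
  (forall s t, 0 <= s <= Tm -> 0 <= t <= Tm -> `|s - t| <= h ->
    `|(x s - w s - c * s + e) - (x t - w t - c * t + e)| <= eta') ->
  forall k, k%:R * h <= Tm ->
  `|csum (dep c h b (incr h w) e) k - departure c x w e (k%:R * h)| <= 3 * eta + eta'.
Proof.
move=> h0 ux uw w0 e0 eta0 eta0' hb hy.
have [y yE] : {y | forall s, y s = x s - w s - c * s + e} by exists (fun s => x s - w s - c * s + e).
have [yd ydE] : {yd | forall k : nat, yd k = e + csum b k - w (k%:R * h) - c * (k%:R * h)}.
  by exists (fun k => e + csum b k - w (k%:R * h) - c * (k%:R * h)).
have [q qE] : {q | forall k, q k = qrec c h e b (incr h w) k}.
  by exists (qrec c h e b (incr h w)).
have [I IE] : {I | forall k, I k = yd k - q k} by exists (fun k => yd k - q k).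
have [xi xE] : {xi | forall k, xi k = yd k.+1 - yd k} by exists (fun k => yd k.+1 - yd k).
have {}hy s t : 0 <= s <= Tm -> 0 <= t <= Tm -> `|s - t| <= h -> `|y s - y t| <= eta'.
  by rewrite !yE; exact: hy.
have xiE k : xi k = b k - incr h w k - c * h.
  by rewrite xE !ydE csumS /incr mulrSr; ring.
have ydy k : k%:R * h <= Tm -> `|yd k - y (k%:R * h)| <= eta.
  move=> kT; rewrite (_ : yd k - _ = csum b k - x (k%:R * h)) ?hb //.
  by rewrite ydE yE; ring.
have kh0 k : 0 <= k%:R * h by rewrite mulr_ge0 // ltW.
have mono (j k : nat) : (j <= k)%N -> j%:R * h <= k%:R * h.
  by move=> jk; rewrite ler_pM2r // ler_nat.
have xib k : k.+1%:R * h <= Tm -> `|xi k| <= 2 * eta + eta'.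
  move=> kT; have kT' := le_trans (mono _ _ (leqnSn k)) kT.
  have := ydy _ kT; have := ydy _ kT'.
  have : `|y (k.+1%:R * h) - y (k%:R * h)| <= eta'.
    by apply: hy; rewrite ?kh0 //= mulrSr mulrDl mul1r addrAC subrr add0r gtr0_norm.
  by rewrite xE !ler_norml; lra.
have qS k : q k.+1 = if 0 <= q k + xi k then q k + xi k else q k.
  by rewrite !qE /= /qstep xiE !addrA.
have q0 k : 0 <= q k by rewrite qE; exact: qrec_ge0.
have I0 : I 0%N = 0 by rewrite IE ydE qE /= /csum big_ord0 mul0r w0; ring.
have IS k : I k.+1 = if 0 <= q k + xi k then I k else I k + xi k.
  have -> : I k.+1 = yd k + xi k - q k.+1 by rewrite IE xE; ring.
  by rewrite IE qS; case: ifP => _; ring.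
have Ile k : I k.+1 <= I k.
  by rewrite IS; case: ifP => // /negbT; rewrite -ltNge => h1; have := q0 k; lra.
have Imono j k : (j <= k)%N -> I k <= I j.
  move=> /subnK <-; elim: (k - j)%N => // i IH.
  by apply: le_trans IH; rewrite addSn.
have Ineg k : I k <= 0 by rewrite -I0; exact: Imono.
have Iy j k : (j <= k)%N -> I k <= yd j.
  by move=> /Imono /le_trans; apply; rewrite IE gerBl.
(* After a cancellation [I k.+1 = yd k.+1 - q k] with [q k < - xi k <= 2 * eta + eta']; an accepted
   step keeps the earlier witness. *)
have Ilow k : k%:R * h <= Tm ->
    I k = 0 \/ exists2 j, (j <= k)%N & yd j - (2 * eta + eta') <= I k.
  elim: k => [_|k IH kT]; first by left.
  have kT' := le_trans (mono _ _ (leqnSn k)) kT.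
  rewrite IS; case: ifP => [_|/negbT]; last rewrite -ltNge => hq.
    have [->|[j jk hj]] := IH kT'; first by left.
    by right; exists j => //; exact: leqW.
  right; exists k.+1 => //.
  have := xib _ kT; rewrite ler_norml IE.
  have -> : yd k.+1 = yd k + xi k by rewrite xE; ring.
  by have := q0 k; lra.
move=> k kT.
have um := lucont_departure_in c e ux uw.
rewrite csum_dep -qE.
have -> : csum b k + e - q k = w (k%:R * h) + c * (k%:R * h) + I k by rewrite IE ydE; ring.
rewrite /departure opprD addrACA subrr add0r.
(* Lower bound: the overshoot [2 * eta + eta'], plus [eta] for passing from [yd j] to [y]. Upper
   bound: the grid point just below [s] costs only [eta + eta']. *)
rewrite ler_distl; apply/andP; split.
  rewrite lerBlDr.
  have [->|[j jk hj]] := Ilow _ kT.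
    rewrite add0r; apply: le_trans (rinf_le um (s := 0) _) _; first by rewrite lexx kh0.
    by apply: le_trans (_ : 0 <= _); [rewrite ge_min lexx orbT|lra].
  apply: le_trans (rinf_le um (s := j%:R * h) _) _; first by rewrite kh0 mono.
  apply: le_trans (_ : y (j%:R * h) <= _); first by rewrite yE ge_min lexx.
  by have := ydy _ (le_trans (mono _ _ jk) kT); rewrite ler_distl; lra.
rewrite -lerBlDr; apply: rinf_ge => // s /[dup] sk /andP[s0 sk'].
rewrite le_min; apply/andP; split; last by have := Ineg k; lra.
have [j jk /andP[j1 j2]] := grid_near h0 sk.
have jT := le_trans (mono _ _ jk) kT.
have : `|y s - y (j%:R * h)| <= eta'.
  by apply: hy; rewrite ?s0 ?kh0 ?jT ?(le_trans sk') // ger0_norm.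
have := ydy _ jT; have := Iy _ _ jk; rewrite -yE.
move: (yd j) (y (j%:R * h)) (y s) (I k) => u1 u2 u3 u4.
by rewrite !ler_distl; lra.
Qed.

Lemma dlayer_close c x (w : nat -> R -> R) (e : nat -> R) n :
  lucont x -> x 0 = 0 -> (forall k, lucont (w k)) -> (forall k, w k 0 = 0) -> (forall k, 0 <= e k) ->
  forall Tm (eps : R), 0 < eps -> exists2 h0, 0 < h0 & forall h, 0 < h <= h0 ->
  forall k, k%:R * h <= Tm ->
  `|csum (dlayer c h (incr h x) (fun i => incr h (w i)) e n) k - layer c x w e n (k%:R * h)| <= eps.
Proof.
move=> ux x0 uw w0 e0; elim: n => [|n IH] Tm eps eps0.
  by exists 1 => // h _ k _ /=; rewrite csum_incr x0 subr0 subrr normr0 ltW.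
(* [dep_close] returns [3 * eta + eta']; both are taken to be a quarter of [eps]. *)
have eps4 : 0 < eps / 4 by rewrite divr_gt0.
have [h1 h10 {}IH] := IH Tm _ eps4.
have ul := lucont_layer c e n ux uw.
have uy : lucont (fun s => layer c x w e n s - w n s - c * s + e n).
  apply: lucontD; last exact: lucont_cst.
  apply: lucontD; first by apply: lucontD => //; exact: lucontN.
  by apply: lucontN; apply: lucontZ; exact: lucont_id.
have [d d0 hd] := uy Tm _ eps4.
exists (Num.min h1 d); first by rewrite lt_min h10.
move=> h; rewrite le_min => /and3P[h0 hh1 hhd] k kT.
have -> : eps = 3 * (eps / 4) + eps / 4 by field.
apply: (dep_close (Tm := Tm)) => //; try exact: ltW.
  by move=> j jT; apply: IH => //; rewrite h0.
by move=> s t sT tT st; apply: hd => //; exact: le_trans hhd.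
Qed.

(** * Piecewise linear interpolation and rounding *)

Definition clamp (u : R) := Num.max 0 (Num.min u 1).

Lemma clamp_lip (u v : R) : `|clamp u - clamp v| <= `|u - v|.
Proof.
wlog uv : u v / u <= v => [H|].
  by have [/H//|/ltW/H] := leP u v; rewrite distrC (distrC u).
rewrite (distrC u) (ger0_norm (x := v - u)) ?subr_ge0 // /clamp !maxEle !minEle ler_norml.
case: (leP u 1) => u1; case: (leP v 1) => v1; rewrite ?ler01;
  case: (leP 0 u) => u0; case: (leP 0 v) => v0; lra.
Qed.

(** Piecewise linear interpolation written as a sum of ramps, ramp [j] rising from [0] to [1] on
    cell [j]. The path is thus Lipschitz on the whole line and constant after [M] cells. *)
Definition interp h M b t := \sum_(j < M) b j * clamp (t / h - j%:R).

Lemma lucont_interp h M b : 0 < h -> lucont (interp h M b).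
Proof.
move=> h0; apply: (@lucont_lip _ _ (\sum_(j < M) `|b j| / h)) => s t _ _.
rewrite /interp -sumrB mulr_suml; apply: le_trans (ler_norm_sum _ _ _) _.
apply: ler_sum => j _; rewrite -mulrBr normrM -mulrA ler_wpM2l //.
apply: le_trans (_ : `|s / h - t / h| <= _).
  have -> : s / h - t / h = (s / h - j%:R) - (t / h - j%:R) by ring.
  exact: clamp_lip.
by rewrite -mulrBl normrM (gtr0_norm (x := h^-1)) ?invr_gt0 // mulrC.
Qed.

Lemma interp_grid h M b t k : 0 < h -> (k < M)%N -> 0 <= t - k%:R * h <= h ->
  interp h M b t = csum b k + b k * (t / h - k%:R).
Proof.
move=> h0 kM /andP[t0 t1]; rewrite /interp.
have u0 : 0 <= t / h - k%:R by rewrite subr_ge0 ler_pdivlMr // -subr_ge0.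
have u1 : t / h - k%:R <= 1 by rewrite lerBlDr ler_pdivrMr // mulrDl mul1r; lra.
rewrite -(big_mkord xpredT (fun j => b j * clamp (t / h - j%:R))).
rewrite (big_cat_nat (n := k)) //=; last exact: ltnW.
rewrite [X in _ + X]big_ltn // [X in _ + (_ + X)]big_nat_cond [X in _ + (_ + X)]big1 => [|j /andP[/andP[kj jM] _]].
  rewrite addr0; congr (_ + _).
    rewrite /csum big_mkord; apply: eq_bigr => j _; rewrite /clamp.
    have jk : j%:R + 1 <= k%:R :> R by rewrite natr1 ler_nat.
    have v1 : 1 <= t / h - j%:R by lra.
    by rewrite (min_idPr v1) (max_idPr ler01) mulr1.
  by rewrite /clamp (min_idPl u1) (max_idPr u0).
have jk : k%:R + 1 <= j%:R :> R by rewrite natr1 ler_nat.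
have v0 : t / h - j%:R <= 0 by lra.
by rewrite /clamp (min_idPl (le_trans v0 ler01)) (max_idPl v0) mulr0.
Qed.

(** On a cell the interpolation is a convex combination of the two neighbouring grid values, each
    within [eta + eta'] of [x t]. The horizon is [Tm + h] because the right neighbour may lie beyond
    [Tm]. *)
Lemma interp_close h M b x Tm (eta eta' : R) : 0 < h -> Tm + h <= M%:R * h ->
  (forall k, k%:R * h <= Tm + h -> `|csum b k - x (k%:R * h)| <= eta) ->
  (forall s t, 0 <= s <= Tm + h -> 0 <= t <= Tm + h -> `|s - t| <= h -> `|x s - x t| <= eta') ->
  forall t, 0 <= t <= Tm -> `|interp h M b t - x t| <= eta + eta'.
Proof.
move=> h0 hM hb hx t tT; have th0 : 0 <= t / h by case/andP: tT => t00 _; rewrite divr_ge0 // ltW.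
have /andP[t1 t2] := truncn_itv th0; move: (Num.truncn (t / h)) t1 t2 => k.
rewrite ler_pdivlMr // ltr_pdivrMr // mulrSr mulrDl mul1r => t1 t2.
have kh : 0 <= k%:R * h by rewrite mulr_ge0 // ltW.
have kM : (k < M)%N.
  rewrite -(ltr_nat R) -(ltr_pM2r h0); move: hM tT; lra.
rewrite (interp_grid b h0 kM); last lra.
have hb0 := hb k; have hb1 := hb k.+1; rewrite mulrSr mulrDl mul1r in hb1.
have /hb0 {}hb0 : k%:R * h <= Tm + h by lra.
have /hb1 {}hb1 : k%:R * h + h <= Tm + h by lra.
rewrite csumS in hb1.
have hx0 : `|x t - x (k%:R * h)| <= eta' by apply: hx; rewrite ?ger0_norm; lra.
have hx1 : `|x t - x (k%:R * h + h)| <= eta'.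
  by apply: hx; rewrite ?ler0_norm; lra.
have u0 : 0 <= t / h - k%:R by rewrite subr_ge0 ler_pdivlMr.
have u1 : t / h - k%:R <= 1 by rewrite lerBlDr ler_pdivrMr // mulrDl mul1r; lra.
move: (t / h - k%:R) u0 u1 => u u0 u1.
move: hb0 hb1 hx0 hx1; rewrite !ler_norml => /andP[a1 a2] /andP[b1 b2] /andP[c1 c2] /andP[d1 d2].
have E1 : csum b k - x t <= eta + eta' by lra.
have E2 : csum b k + b k - x t <= eta + eta' by lra.
have E3 : - (eta + eta') <= csum b k - x t by lra.
have E4 : - (eta + eta') <= csum b k + b k - x t by lra.
have -> : csum b k + b k * u - x t =
  (1 - u) * (csum b k - x t) + u * (csum b k + b k - x t) by ring.
by apply/andP; split; nra.
Qed.

(** Three scales tied together: mesh [1 / (N+1)], [(N+1)^2] cells so that the horizon is [N+1], and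
    rounding unit [(N+1)^-3] so that the rounding errors of all cells add up to at most one mesh. *)
Definition hN (N : nat) : R := N.+1%:R^-1.
Definition MN (N : nat) := (N.+1 * N.+1)%N.
Definition etaN (N : nat) : R := (N.+1%:R * N.+1%:R * N.+1%:R)^-1.

Lemma hN_gt0 N : 0 < hN N. Proof. by rewrite invr_gt0. Qed.
Lemma etaN_gt0 N : 0 < etaN N. Proof. by rewrite invr_gt0 !mulr_gt0. Qed.

Lemma hN_small (eps : R) : 0 < eps -> exists N0, forall N, (N0 <= N)%N -> hN N <= eps.
Proof.
move=> e0; exists (Num.truncn eps^-1) => N NN; rewrite /hN -[leRHS]invrK lef_pV2 ?posrE ?invr_gt0 //.
by apply: le_trans (ltW (truncnS_gt _)) _; rewrite ler_nat ltnS.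
Qed.

(* Rounding the increments makes the approximation range over countably many paths. *)
Definition decode N (k : nat) : R -> R :=
  interp (hN N) (MN N) (fun j => (nth 0 (odflt [::] (unpickle k)) j : int)%:~R * etaN N).

Definition code N b : nat := pickle [seq Num.floor (b j / etaN N) | j <- iota 0 (MN N)].

Lemma decode_code N b :
  decode N (code N b) = interp (hN N) (MN N) (fun j => (Num.floor (b j / etaN N))%:~R * etaN N).
Proof.
apply/funext => t; rewrite /decode /code pickleK /odflt /oapp /interp; apply: eq_bigr => j _.
by rewrite (nth_map 0%N) ?size_iota // nth_iota.
Qed.

Lemma csum_round N b k : (k <= MN N)%N ->
  `|csum (fun j => (Num.floor (b j / etaN N))%:~R * etaN N) k - csum b k| <= hN N.
Proof.
move=> kM; rewrite /csum -sumrB; apply: le_trans (ler_norm_sum _ _ _) _.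
apply: le_trans (_ : \sum_(j < k) etaN N <= _).
  apply: ler_sum => j _; rewrite distrC.
  rewrite -[X in X - _](divfK (lt0r_neq0 (etaN_gt0 N))) -mulrBl normrM (gtr0_norm (etaN_gt0 _)).
  rewrite ger_pMl ?etaN_gt0 //.
  move: (b j / etaN N) => u; have /andP[u1 u2] := real_floor_itv (num_real u).
  by rewrite ger0_norm ?subr_ge0 // lerBlDl; move: (ltW u2); rewrite intrD.
rewrite sumr_const card_ord -mulr_natl.
apply: le_trans (_ : (MN N)%:R * etaN N <= _).
  by rewrite ler_pM2r ?etaN_gt0 // ler_nat.
rewrite /MN /etaN /hN natrM.
have : N.+1%:R != 0 :> R by [].
by move: (N.+1%:R) => a a0; rewrite le_eqVlt; apply/orP; left; apply/eqP; field.
Qed.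

Definition approx c x (w : nat -> R -> R) (e : nat -> R) n N : nat :=
  code N (dlayer c (hN N) (incr (hN N) x) (fun i => incr (hN N) (w i)) e n).

Lemma lucont_decode N k : lucont (decode N k).
Proof. by apply: lucont_interp; exact: hN_gt0. Qed.

Lemma approx_cvg c x (w : nat -> R -> R) (e : nat -> R) n :
  lucont x -> x 0 = 0 -> (forall k, lucont (w k)) -> (forall k, w k 0 = 0) -> (forall k, 0 <= e k) ->
  lucvg (fun N => decode N (approx c x w e n N)) (layer c x w e n).
Proof.
move=> ux x0 uw w0 e0 Tm eps eps0.
have eps3 : 0 < eps / 3 by rewrite divr_gt0.
have [h0 h00 H0] := dlayer_close c n ux x0 uw w0 e0 (Tm + 1) eps3.
have [d d0 hd] := lucont_layer c e n ux uw (Tm + 1) eps3.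
have m0 : 0 < Num.min h0 (Num.min d (eps / 3)) by rewrite !lt_min h00 d0.
have [N1 HN1] := hN_small m0.
(* The second bound makes the horizon [N+1] at least [Tm + 1]; the extra unit of time leaves room
   for one mesh. *)
exists (maxn N1 (Num.truncn (Tm + 1))) => N; rewrite geq_max => /andP[/HN1 + N2] t tT.
rewrite !le_min => /and3P[Nh0 Nd Ne].
have h1 : hN N <= 1 by rewrite /hN invf_le1 // ler1n.
have hp := hN_gt0 N.
rewrite /approx decode_code.
have -> : eps = (eps / 3 + eps / 3) + eps / 3 by field.
have TM : Tm + 1 <= (MN N)%:R * hN N.
  rewrite /MN /hN natrM mulfK //; apply: le_trans (ltW (truncnS_gt _)) _.
  by rewrite ler_nat ltnS.
apply: (interp_close (Tm := Tm)) => //.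
- by apply: le_trans TM; rewrite lerD2l.
- move=> k kT.
  have kM : (k <= MN N)%N.
    by rewrite -(ler_nat R) -(ler_pM2r hp); lra.
  have A := le_trans (csum_round (dlayer c (hN N) (incr (hN N) x) (fun i => incr (hN N) (w i)) e n) kM) Ne.
  have B := H0 (hN N); rewrite hp Nh0 in B.
  have {}B := B isT k; have /B {}B : k%:R * hN N <= Tm + 1 by lra.
  by move: A B; rewrite !ler_norml; lra.
- move=> s u /andP[s0 sT] /andP[u0' uT] su; apply: hd; rewrite ?s0 ?u0' /=; lra.
Qed.

End discrete.

(** * Exact invariance of one grid step *)

Section affine.
Context {R : realType}.
Local Notation mu := (@lebesgue_measure R).
Local Open Scope ereal_scope.

Lemma lebesgue_affine (k a : R) (A : set R) : (0 < k)%R -> measurable A ->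
  k%:E * mu ((fun x => k * x + a)%R @^-1` A) = mu A.
Proof.
move=> k0 mA.
have mf : measurable_fun setT ((fun x => k * x + a)%R : measurableTypeR R -> measurableTypeR R).
  by apply: measurable_funD => //; exact: measurable_funM.
pose f : {mfun measurableTypeR R >-> measurableTypeR R} :=
  HB.pack ((fun x => k * x + a)%R : measurableTypeR R -> measurableTypeR R)
    (isMeasurableFun.Build _ _ _ _ _ mf).
pose kn : {nonneg R} := NngNum (ltW k0).
apply/esym/(lebesgue_measure_unique (mu := mscale kn (pushforward mu f))) => //.
move=> _ [[x y]] _ <-; rewrite /mscale /pushforward.
have E : f @^-1` [set` `]x, y]%R] = [set` `]((x - a) / k)%R, ((y - a) / k)%R]%R].
  by apply/seteqP; split=> z /=; rewrite !in_itv /= ltr_pdivrMr // ler_pdivlMr // ltrBlDr lerBrDr (mulrC k).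
transitivity (k%:E * mu [set` `]((x - a) / k)%R, ((y - a) / k)%R]%R]).
  rewrite !lebesgue_measure_itv /= !lte_fin ltr_pM2r ?invr_gt0 // ltrD2r.
  case: ifP => _; last by rewrite mule0.
  by rewrite -!EFinD -EFinM; congr EFin; field; rewrite gt_eqF.
by rewrite -E.
Qed.

Lemma integral_affine (k a : R) (f : R -> \bar R) : (0 < k)%R ->
  measurable_fun setT f -> (forall x, 0 <= f x) ->
  k%:E * \int[mu]_x f (k * x + a)%R = \int[mu]_x f x.
Proof.
move=> k0 mf f0.
have mg : measurable_fun setT ((fun x => k * x + a)%R : measurableTypeR R -> measurableTypeR R).
  by apply: measurable_funD => //; exact: measurable_funM.
pose g : {mfun measurableTypeR R >-> measurableTypeR R} :=
  HB.pack ((fun x => k * x + a)%R : measurableTypeR R -> measurableTypeR R)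
    (isMeasurableFun.Build _ _ _ _ _ mg).
pose kn : {nonneg R} := NngNum (ltW k0).
have E := ge0_integral_pushforward mg mu measurableT (mf : measurable_fun [set: measurableTypeR R] f) (fun y _ => f0 y).
rewrite preimage_setT in E; rewrite -{}E.
rewrite -(ge0_integral_mscale _ _ kn) //.
apply: eq_measure_integral => A mA _.
exact: lebesgue_affine.
Qed.

Lemma integral_shift (a : R) (f : R -> \bar R) :
  measurable_fun setT f -> (forall x, 0 <= f x) ->
  \int[mu]_x f (x + a)%R = \int[mu]_x f x.
Proof.
move=> mf f0; rewrite -(integral_affine a (ltr01) mf f0) mul1e.
by apply: eq_integral => x _; rewrite mul1r.
Qed.

End affine.

Section density.
Context {d} {T : measurableType d} {R : realType}.
Variables (mu nu : {measure set T -> \bar R}) (g : T -> R).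
Hypotheses (mg : measurable_fun setT g) (g0 : forall x, 0 <= g x)
  (nuE : forall A, measurable A -> nu A = (\int[mu]_(x in A) (g x)%:E)%E).
Local Open Scope ereal_scope.
Import HBNNSimple.

Let density_nnsfun (f : {nnsfun T >-> R}) :
  \int[nu]_x (f x)%:E = \int[mu]_x (f x * g x)%:E.
Proof.
under eq_integral do rewrite fimfunE -fsumEFin //.
rewrite ge0_integral_fsum//; last 2 first.
  - by move=> r; exact/measurable_EFinP/measurableT_comp.
  - by move=> n x _; rewrite EFinM nnfun_muleindic_ge0.
transitivity (\sum_(r \in range f) \int[mu]_x (r * \1_(f @^-1` [set r]) x * g x)%:E).
  apply: eq_fsbigr => r /[!inE] -[x _ fxr].
  have r0 : (0 <= r)%R by rewrite -fxr.
  under [RHS]eq_integral do rewrite -mulrA EFinM.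
  under [LHS]eq_integral do rewrite EFinM.
  have mr : measurable (f @^-1` [set r]) by exact: measurable_sfunP.
  rewrite !ge0_integralZl //=.
  - rewrite integral_indic // setIT nuE // integral_mkcond; congr (_ * _).
    apply: eq_integral => y _; rewrite patchE indicE.
    by case: ifP => _; rewrite ?mul1r ?mul0r.
  - by apply/measurable_EFinP; apply: measurable_funM => //; exact: measurable_indic.
  - by move=> y _; rewrite lee_fin mulr_ge0.
  - by apply/measurable_EFinP; exact: measurable_indic.
rewrite -ge0_integral_fsum//; last 2 first.
  - move=> r; apply/measurable_EFinP; apply: measurable_funM => //.
    by apply: measurable_funM => //; exact: measurable_indic.
  - by move=> n x _; rewrite EFinM mule_ge0 ?lee_fin // -lee_fin EFinM nnfun_muleindic_ge0.
apply: eq_integral => x _.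
rewrite fsumEFin // -mulr_fsuml.
by rewrite -fimfunE.
Qed.

(** Monotone convergence from simple functions. It turns Gaussian and exponential laws into Lebesgue
    integrals, where translations are available. *)
Lemma ge0_integral_density (f : T -> \bar R) :
  measurable_fun setT f -> (forall x, 0 <= f x) ->
  \int[nu]_x f x = \int[mu]_x (f x * (g x)%:E).
Proof.
move=> mf f0.
pose f_ := nnsfun_approx measurableT mf.
have fcvg x : (f_ n x)%:E @[n --> \oo] --> f x by exact: cvg_nnsfun_approx.
have H1 : (\int[nu]_x (f_ n x)%:E) @[n --> \oo] --> \int[nu]_x f x.
  rewrite (_ : \int[nu]_x f x = \int[nu]_x limn (fun n => (f_ n x)%:E)).
    apply: cvg_monotone_convergence => //.
    - by move=> n; exact/measurable_EFinP.
    - by move=> n x _; rewrite lee_fin.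
    - by move=> x _ m n mn; rewrite lee_fin; exact/lefP/nd_nnsfun_approx.
  by apply: eq_integral => x _; apply/esym/cvg_lim.
have gcvg x : (f_ n x * g x)%:E @[n --> \oo] --> f x * (g x)%:E.
  by under eq_fun do rewrite EFinM; apply: cvgeZr.
have H2 : (\int[mu]_x (f_ n x * g x)%:E) @[n --> \oo] --> \int[mu]_x (f x * (g x)%:E).
  rewrite (_ : \int[mu]_x _ = \int[mu]_x limn (fun n => (f_ n x * g x)%:E)).
    apply: cvg_monotone_convergence => //.
    - by move=> n; apply/measurable_EFinP; exact: measurable_funM.
    - by move=> n x _; rewrite lee_fin mulr_ge0.
    - move=> x _ m n mn; rewrite lee_fin ler_wpM2r //.
      exact/lefP/nd_nnsfun_approx.
  by apply: eq_integral => x _; apply/esym/cvg_lim.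
have E : (fun n => \int[nu]_x (f_ n x)%:E) = (fun n => \int[mu]_x (f_ n x * g x)%:E).
  by apply/funext => n; exact: density_nnsfun.
by rewrite E in H1; exact: (cvg_unique _ H1 H2).
Qed.

End density.

Section iterated_integral.
Context {R : realType}.
Local Notation mu := (@lebesgue_measure R).
Implicit Types F G : R -> R -> R -> R.

(** Iterated instead of over a product, so that each change of variable acts on one coordinate; [q]
    is innermost so that it can be translated by an amount depending on [w] and [b]. *)
Definition int3 F : \bar R := (\int[mu]_w \int[mu]_b \int[mu]_q (F w b q)%:E)%E.

Definition meas3 F := measurable_fun [set: R * R * R] (fun z => F z.1.1 z.1.2 z.2).
Definition pos3 F := forall w b q, 0 <= F w b q.

Lemma meas3_comp F (f g k : R * R * R -> R) : meas3 F -> measurable_fun setT f ->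
  measurable_fun setT g -> measurable_fun setT k ->
  measurable_fun [set: R * R * R] (fun z => F (f z) (g z) (k z)).
Proof.
move=> mF mf mg mk.
apply: (measurableT_comp (f := fun z : R * R * R => F z.1.1 z.1.2 z.2)
   (g := fun z => ((f z, g z), k z)) mF).
by apply: measurable_fun_pair => //; exact: measurable_fun_pair.
Qed.

Lemma meas3_in F w b : meas3 F -> measurable_fun [set: R] (F w b).
Proof. by move=> mF; exact: (measurable_fun_pair2 (w, b) mF). Qed.

Lemma meas3_mid F : meas3 F -> pos3 F ->
  measurable_fun [set: R * R] (fun p => \int[mu]_q (F p.1 p.2 q)%:E)%E.
Proof.
move=> mF F0.
apply: (measurable_fun_fubini_tonelli_F (m2 := mu) (fun z : R * R * R => (F z.1.1 z.1.2 z.2)%:E)).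
  exact/measurable_EFinP.
by move=> z; rewrite lee_fin.
Qed.

Lemma meas3_mid2 F w : meas3 F -> pos3 F ->
  measurable_fun [set: R] (fun b => \int[mu]_q (F w b q)%:E)%E.
Proof. by move=> mF F0; exact: (measurable_fun_pair2 w (meas3_mid mF F0)). Qed.

Lemma meas3_out F : meas3 F -> pos3 F ->
  measurable_fun [set: R] (fun w => \int[mu]_b \int[mu]_q (F w b q)%:E)%E.
Proof.
move=> mF F0.
apply: (measurable_fun_fubini_tonelli_F (m2 := mu)
  (fun p : R * R => \int[mu]_q (F p.1 p.2 q)%:E)%E); first exact: meas3_mid.
by move=> z; apply: integral_ge0 => q _; rewrite lee_fin.
Qed.

Lemma int3D F G : meas3 F -> pos3 F -> meas3 G -> pos3 G ->
  (int3 F + int3 G)%E = int3 (fun w b q => F w b q + G w b q).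
Proof.
move=> mF F0 mG G0; rewrite /int3 -ge0_integralD //=.
- apply: eq_integral => w _; rewrite -ge0_integralD //=.
  + apply: eq_integral => b _; rewrite -ge0_integralD //=.
    * by move=> q _; rewrite lee_fin.
    * by apply/measurable_EFinP; exact: meas3_in.
    * by move=> q _; rewrite lee_fin.
    * by apply/measurable_EFinP; exact: meas3_in.
  + by move=> b _; apply: integral_ge0 => q _; rewrite lee_fin.
  + exact: meas3_mid2.
  + by move=> b _; apply: integral_ge0 => q _; rewrite lee_fin.
  + exact: meas3_mid2.
- by move=> w _; do 2 (apply: integral_ge0 => ? _); rewrite lee_fin.
- exact: meas3_out.
- by move=> w _; do 2 (apply: integral_ge0 => ? _); rewrite lee_fin.
- exact: meas3_out.
Qed.

Lemma int3_shift1 F a : meas3 F -> pos3 F -> int3 (fun w => F (w + a)) = int3 F.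
Proof.
move=> mF F0; rewrite /int3.
rewrite (integral_shift a (f := fun w => \int[mu]_b \int[mu]_q (F w b q)%:E)%E) //.
  exact: meas3_out.
by move=> w; do 2 (apply: integral_ge0 => ? _); rewrite lee_fin.
Qed.

Lemma int3_shift2 F a : meas3 F -> pos3 F -> int3 (fun w b => F w (b + a)) = int3 F.
Proof.
move=> mF F0; rewrite /int3; apply: eq_integral => w _.
rewrite (integral_shift a (f := fun b => \int[mu]_q (F w b q)%:E)%E) //.
  exact: meas3_mid2.
by move=> b; apply: integral_ge0 => ? _; rewrite lee_fin.
Qed.

Lemma int3_shift3 F (a : R -> R -> R) : meas3 F -> pos3 F ->
  int3 (fun w b q => F w b (q + a w b)) = int3 F.
Proof.
move=> mF F0; rewrite /int3; apply: eq_integral => w _; apply: eq_integral => b _.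
rewrite (integral_shift (a w b) (f := fun q => (F w b q)%:E)) //.
  by apply/measurable_EFinP; exact: meas3_in.
by move=> q; rewrite lee_fin.
Qed.

Lemma int3_swap F : meas3 F -> pos3 F -> int3 (fun w b => F b w) = int3 F.
Proof.
move=> mF F0; rewrite /int3.
rewrite (fubini_tonelli (m1 := mu) (m2 := mu) (fun p : R * R => \int[mu]_q (F p.1 p.2 q)%:E)%E) //.
  exact: meas3_mid.
by move=> z; apply: integral_ge0 => q _; rewrite lee_fin.
Qed.

End iterated_integral.

Section product_law.
Context {R : realType}.
Variables (c h : R).
Hypothesis c0 : 0 < c.
Local Notation mu := (@lebesgue_measure R).

Definition exp_law : probability (measurableTypeR R) R :=
  exponential_distribution_exponential_prob__canonical__probability_measure_Probability c0.
Definition gauss_law : probability (measurableTypeR R) R := normal_prob 0 (Num.sqrt h).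

Local Notation g := (normal_pdf 0 (Num.sqrt h)).
Local Notation r := (exponential_pdf c).

Let g0 x : 0 <= g x. Proof. exact: normal_pdf_ge0. Qed.
Let r0 x : 0 <= r x. Proof. by apply: exponential_pdf_ge0; exact: ltW. Qed.
Let mg : measurable_fun setT g. Proof. exact: measurable_normal_pdf. Qed.
Let mr : measurable_fun setT r. Proof. exact: measurable_exponential_pdf. Qed.

Definition law2 : probability (measurableTypeR R * measurableTypeR R)%type R :=
  (gauss_law \x gauss_law)%E.
Definition law3 : probability (measurableTypeR R * measurableTypeR R * measurableTypeR R)%type R :=
  (law2 \x exp_law)%E.

Lemma law3E (S : set (R * R * R)) : measurable S ->
  law3 S = int3 (fun w b q => \1_S ((w, b), q) * (g w * (g b * r q))).
Proof.
move=> mS.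
transitivity (\int[law3]_z (\1_S z)%:E)%E.
  by rewrite (@integral_indic _ _ R law3 setT measurableT S mS) setIT.
have mI : measurable_fun setT (fun z : R * R * R => (\1_S z)%:E : \bar R).
  by apply/measurable_EFinP; exact: measurable_indic.
have I0 (z : R * R * R) : (0 <= (\1_S z)%:E :> \bar R)%E by rewrite lee_fin.
rewrite (fubini_tonelli1 (m1 := law2) (m2 := exp_law)
  (fun z => (\1_S z)%:E)) // /fubini_F.
have mF := measurable_fun_fubini_tonelli_F (m2 := exp_law) (fun z => (\1_S z)%:E) mI I0.
have F0 (x : R * R) : (0 <= fubini_F exp_law (fun z => (\1_S z)%:E) x)%E.
  by apply: integral_ge0 => y _.
rewrite (fubini_tonelli1 (m1 := gauss_law) (m2 := gauss_law) _ mF F0) /fubini_F.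
have mG := measurable_fun_fubini_tonelli_F (m2 := gauss_law) _ mF F0.
rewrite (ge0_integral_density (mu := mu) (g := g)) //; last first.
  by move=> w; apply: integral_ge0 => b _; exact: F0.
rewrite /int3; apply: eq_integral => w _.
rewrite (ge0_integral_density (mu := mu) (g := g)) //; last 2 first.
  exact: (measurable_fun_pair2 w mF).
  by move=> b; exact: F0.
have mS1 b : measurable_fun setT (fun q => \1_S (w, b, q) : R).
  exact: (measurable_fun_pair2 (w, b) (@measurable_indic _ _ R setT _ mS)).
have eS b : measurable_fun setT (fun q => (\1_S (w, b, q))%:E : \bar R).
  by apply/measurable_EFinP; exact: mS1.
have er : measurable_fun setT (fun q => (r q)%:E) by exact/measurable_EFinP.
rewrite -ge0_integralZr //=; first last.
- by rewrite lee_fin.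
- by move=> b _; rewrite mule_ge0 ?lee_fin //; exact: (F0 (w, b)).
- apply: emeasurable_funM; first exact: (measurable_fun_pair2 w mF).
  exact/measurable_EFinP.
apply: eq_integral => b _.
rewrite (ge0_integral_density (mu := mu) (g := r)) //.
rewrite -!ge0_integralZr //=; try by rewrite lee_fin.
- by apply: eq_integral => q _; rewrite -!EFinM; congr EFin; ring.
- by apply: emeasurable_funM => //; apply: emeasurable_funM; [exact: eS|exact: er].
- by move=> q _; rewrite -!EFinM lee_fin !mulr_ge0.
- by apply: emeasurable_funM; [exact: eS|exact: er].
- by move=> q _; rewrite -!EFinM lee_fin !mulr_ge0.
- exact: eS.
Qed.

End product_law.

Section measurable_steps.
Context {R : realType} {d} {T : measurableType d}.
Variables (c h : R) (q b w : T -> R).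
Hypotheses (mq : measurable_fun setT q) (mb : measurable_fun setT b) (mw : measurable_fun setT w).

Let mu_ : measurable_fun setT (fun t => q t + b t - w t - c * h).
Proof.
apply: measurable_funB => //; apply: measurable_funB => //; exact: measurable_funD.
Qed.

Let mc : measurable_fun setT (fun t => 0 <= q t + b t - w t - c * h).
Proof. exact: (measurable_fun_ler (measurable_cst _) mu_). Qed.

Lemma measurable_qstep : measurable_fun setT (fun t => qstep c h (q t) (b t) (w t)).
Proof. exact: measurable_fun_ifT. Qed.

Lemma measurable_dstep : measurable_fun setT (fun t => dstep c h (q t) (b t) (w t)).
Proof. by apply: measurable_fun_ifT => //; exact: measurable_funD. Qed.

End measurable_steps.

Section one_step.
Context {R : realType}.
Variables (c h : R).
Hypotheses (c0 : 0 < c) (h0 : 0 < h).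

Local Notation g := (normal_pdf 0 (Num.sqrt h)).
Local Notation r := (exponential_pdf c).

Let g0 x : 0 <= g x. Proof. exact: normal_pdf_ge0. Qed.
Let r0 x : 0 <= r x. Proof. by apply: exponential_pdf_ge0; exact: ltW. Qed.
Let mg : measurable_fun setT g. Proof. exact: measurable_normal_pdf. Qed.
Let mr : measurable_fun setT r. Proof. exact: measurable_exponential_pdf. Qed.

Let m1 : measurable_fun [set: R * R * R] (fun z => z.1.1).
Proof. exact: (measurableT_comp measurable_fst measurable_fst). Qed.
Let m2 : measurable_fun [set: R * R * R] (fun z => z.1.2).
Proof. exact: (measurableT_comp measurable_snd measurable_fst). Qed.
Let m3 : measurable_fun [set: R * R * R] (fun z => z.2).
Proof. exact: measurable_snd. Qed.

Let acc (u : R) : R := \1_`[0, +oo[ u.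
Let acc_ge0 u : 0 <= acc u. Proof. by rewrite /acc indicE. Qed.
Let acc_le1 u : acc u <= 1. Proof. by rewrite /acc indicE; case: (_ \in _). Qed.
Let accE u : acc u = (0 <= u)%R%:R.
Proof. by rewrite /acc indicE; congr (nat_of_bool _)%:R; apply/idP/idP; rewrite inE /= in_itv /= andbT. Qed.
Let macc : measurable_fun setT acc.
Proof. by apply: measurable_indic; exact: measurable_itv. Qed.

(* The exponential weight of the queue length absorbs the drift [c * h] that
   separates the two Gaussian increments. *)
Lemma gauss_tilt (w b q : R) :
  g (w - c * h) * (g (b + c * h) * expR (- c * (q - (b + c * h) + w))) = g w * (g b * expR (- c * q)).
Proof.
have s0 : Num.sqrt h != 0 by rewrite gt_eqF // sqrtr_gt0.
have gE x : g x = normal_peak (Num.sqrt h) * expR (- x ^+ 2 / (h *+ 2)).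
  by rewrite (normal_pdfE 0 s0) /normal_fun sqr_sqrtr ?(ltW h0) // subr0.
rewrite !gE; move: (normal_peak _) => p.
transitivity (p * p * expR (- (w - c * h) ^+ 2 / (h *+ 2) + (- (b + c * h) ^+ 2 / (h *+ 2) +
   - c * (q - (b + c * h) + w)))); first by rewrite !expRD; ring.
transitivity (p * p * expR (- w ^+ 2 / (h *+ 2) + (- b ^+ 2 / (h *+ 2) + - c * q))); last first.
  by rewrite !expRD; ring.
congr (_ * expR _); field; rewrite gt_eqF //.
Qed.

Let k w b q := g w * (g b * r q).
Let k0 w b q : 0 <= k w b q. Proof. by rewrite !mulr_ge0. Qed.

Ltac measurability ma mb := repeat first [exact: m1 | exact: m2 | exact: m3 | exact: measurable_cst
  | apply: measurable_funM | apply: measurable_funB | apply: measurable_funD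
  | apply: (measurableT_comp macc) | apply: (measurableT_comp mg) | apply: (measurableT_comp mr)
  | apply: (measurableT_comp ma) | apply: (measurableT_comp mb)].

Let box_mem (A B : set R) w b q :
  ((w, b, q) \in ([set: R] `*` B) `*` A) = (q \in A) && (b \in B).
Proof. by apply/idP/andP; rewrite !inE /= => -[] // []. Qed.

Let law3_box (A B : set R) : measurable A -> measurable B ->
  int3 (fun w b q => \1_(([set: R] `*` B) `*` A) (w, b, q) * (g w * (g b * r q))) =
  (exp_law c0 A * gauss_law h B)%E.
Proof.
move=> mA mB.
have mTB : measurable ([set: R] `*` B) by exact: (measurableX measurableT mB).
have mX : measurable (([set: R] `*` B) `*` A) by exact: (measurableX mTB mA).
rewrite -(law3E h c0 mX).
transitivity (law2 h ([set: R] `*` B) * exp_law c0 A)%E.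
  exact: (product_measure1E (law2 h) (exp_law c0) mTB mA).
rewrite muleC; congr (_ * _)%E.
transitivity (gauss_law h [set: R] * gauss_law h B)%E.
  exact: (product_measure1E (gauss_law h) (gauss_law h) measurableT mB).
by rewrite probability_setT mul1e.
Qed.

(** One time step of the discrete Burke theorem. The independence of the new queue length from the
    departure just emitted is the essential point: the next step starts again from an exponential
    queue independent of the past output. *)
Lemma one_step (A B : set R) : measurable A -> measurable B ->
  law3 h c0 [set z | A (qstep c h z.2 z.1.2 z.1.1) /\ B (dstep c h z.2 z.1.2 z.1.1)] =
  (exp_law c0 A * gauss_law h B)%E.
Proof.
move=> mA mB.
pose a (u : R) : R := \1_A u.
pose b_ (u : R) : R := \1_B u.
have a0 u : 0 <= a u by rewrite /a indicE.
have b0 u : 0 <= b_ u by rewrite /b_ indicE.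
have ma : measurable_fun setT a by exact: measurable_indic.
have mb : measurable_fun setT b_ by exact: measurable_indic.
have mq : measurable_fun [set: R * R * R] (fun z => qstep c h z.2 z.1.2 z.1.1).
  exact: measurable_qstep m3 m2 m1.
have md : measurable_fun [set: R * R * R] (fun z => dstep c h z.2 z.1.2 z.1.1).
  exact: measurable_dstep m3 m2 m1.
have pA := mq measurableT A mA.
have pB := md measurableT B mB.
rewrite setTI in pA.
rewrite setTI in pB.
(* [F1] is the accepted part and [F2] the cancelled part; translations of
   Lebesgue measure and an exchange of [w] and [b] turn [F1] into [G5], which
   complements [F2]. *)
pose F1 w b q := acc (q + b - w - c * h) * (a (q + b - w - c * h) * (b_ (w + c * h) * k w b q)).
pose F2 w b q := (1 - acc (q + b - w - c * h)) * (a q * (b_ b * k w b q)).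
pose G1 w b q := acc (q + b - w) * (a (q + b - w) * (b_ w * (g (w - c * h) * (g b * r q)))).
pose G2 w b q := acc q * (a q * (b_ w * (g (w - c * h) * (g b * r (q - b + w))))).
pose G4 w b q := acc (q - b - c * h + w) * (a q * (b_ w * k w b q)).
pose G5 w b := G4 b w.
have mF1 : meas3 F1 by rewrite /meas3 /F1 /k; measurability ma mb.
have mF2 : meas3 F2 by rewrite /meas3 /F2 /k; measurability ma mb.
have mG1 : meas3 G1 by rewrite /meas3 /G1 /k; measurability ma mb.
have mG2 : meas3 G2 by rewrite /meas3 /G2 /k; measurability ma mb.
have mG4 : meas3 G4 by rewrite /meas3 /G4 /k; measurability ma mb.
have mG5 : meas3 G5 by exact: (meas3_comp mG4 m2 m1 m3).
have pF1 : pos3 F1 by move=> w b q; rewrite /F1 !mulr_ge0.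
have pF2 : pos3 F2 by move=> w b q; rewrite /F2 !mulr_ge0 // subr_ge0.
have pG1 : pos3 G1 by move=> w b q; rewrite /G1 !mulr_ge0.
have pG2 : pos3 G2 by move=> w b q; rewrite /G2 !mulr_ge0.
have pG4 : pos3 G4 by move=> w b q; rewrite /G4 !mulr_ge0.
have pG5 : pos3 G5 by move=> w b q; exact: pG4.
have eq3 (F G : R -> R -> R -> R) : (forall w b q, F w b q = G w b q) -> F = G.
  by move=> E; apply/funext => w; apply/funext => b; apply/funext => q.
have E1 : int3 F1 = int3 G1.
  rewrite -(int3_shift1 (c * h) mG1 pG1); congr int3; apply: eq3 => w b q.
  by rewrite /F1 /G1 /k addrK opprD addrA.
have E2 : int3 G1 = int3 G2.
  rewrite -(int3_shift3 (fun w b => b - w) mG2 pG2); congr int3; apply: eq3 => w b q.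
  have e1 : q + (b - w) - b + w = q by ring.
  by rewrite /G1 /G2 e1 addrA.
(* Acceptance and support exchange roles: [0 <= q] is now enforced by [r q], while the old support
   condition survives as the indicator in [G4]. *)
have E3 : int3 G2 = int3 G4.
  rewrite -(int3_shift2 (c * h) mG2 pG2); congr int3; apply: eq3 => w b q.
  rewrite /G2 /G4 /k !accE.
  have [q0|q0] := leP 0 q; last by rewrite (lt0_exponential_pdf c q0) !(mulr0, mul0r).
  have -> : q - b - c * h + w = q - (b + c * h) + w by rewrite opprD addrA.
  have [u0|u0] := leP 0 (q - (b + c * h) + w); last first.
    by rewrite (lt0_exponential_pdf c u0) !(mulr0, mul0r).
  rewrite (exponential_pdfE c u0) (exponential_pdfE c q0) !mul1r.
  congr (_ * (_ * _)).
  have := congr1 (fun z => c * z) (gauss_tilt w b q); cbv beta => tilt.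
  by rewrite 2!(mulrCA _ c) tilt 2!(mulrCA c).
have E4 : int3 G4 = int3 G5 by apply: esym; exact: int3_swap.
have mS := measurableI _ _ pA pB.
have -> : [set z : R * R * R | A (qstep c h z.2 z.1.2 z.1.1) /\ B (dstep c h z.2 z.1.2 z.1.1)] =
  (fun z => qstep c h z.2 z.1.2 z.1.1) @^-1` A `&` (fun z => dstep c h z.2 z.1.2 z.1.1) @^-1` B.
  by apply/seteqP; split.
rewrite (law3E h c0 mS).
transitivity (int3 (fun w b q => F1 w b q + F2 w b q)).
  congr int3; apply: eq3 => w b q.
  rewrite -/(k w b q) indicE.
  have -> : ((w, b, q) \in (fun z => qstep c h z.2 z.1.2 z.1.1) @^-1` A `&` (fun z => dstep c h z.2 z.1.2 z.1.1) @^-1` B)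
    = (qstep c h q b w \in A) && (dstep c h q b w \in B).
    by apply/idP/andP; rewrite !inE.
  rewrite /F1 /F2 accE /a /b_ !indicE /qstep /dstep; case: ifP => _.
    by rewrite subrr mul0r addr0 mul1r; case: (_ \in A); case: (_ \in B); rewrite ?mul1r ?mul0r.
  by rewrite subr0 mul0r add0r mul1r; case: (_ \in A); case: (_ \in B); rewrite ?mul1r ?mul0r.
rewrite -(int3D mF1 pF1 mF2 pF2) E1 E2 E3 E4 (int3D mG5 pG5 mF2 pF2).
transitivity (int3 (fun w b q => \1_(([set: R] `*` B) `*` A) (w, b, q) * (g w * (g b * r q)))).
  congr int3; apply: eq3 => w b q.
  rewrite -/(k w b q) indicE.
  rewrite (box_mem A B w b q) /G5 /G4 /F2.
  have -> : q - w - c * h + b = q + b - w - c * h by ring.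
  have -> : k b w q = k w b q by rewrite /k mulrCA.
  rewrite -mulrDl subrKC mul1r /a /b_ !indicE.
  by case: (_ \in A); case: (_ \in B); rewrite ?mul1r ?mul0r.
exact: law3_box.
Qed.
End one_step.

(** * Independence through the layers *)

Section independence.
Context {R : realType} {d} {T : measurableType d} (P : probability T R).
Local Open Scope ereal_scope.

(** Rectangles determine the law of the pair under [P] restricted to [C] and normalized, so that law
    is the product measure; the case [P C = 0] is separate because of the normalization. *)
Lemma pair_indep d1 d2 (T1 : measurableType d1) (T2 : measurableType d2)
  (m1 : probability T1 R) (m2 : probability T2 R) (X : T -> T1) (Y : T -> T2) (C : set T) :
  measurable C -> measurable_fun setT X -> measurable_fun setT Y ->
  (forall A B, measurable A -> measurable B ->
    P (C `&` (X @^-1` A `&` Y @^-1` B)) = P C * (m1 A * m2 B)) ->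
  forall S, measurable S -> P (C `&` [set t | S (X t, Y t)]) = P C * (m1 \x m2) S.
Proof.
move=> mC mX mY H S mS.
have mV : measurable_fun setT (fun t => (X t, Y t)) by exact: measurable_fun_pair.
have mVS D : measurable D -> measurable [set t | D (X t, Y t)].
  by move=> mD; have := mV measurableT D mD; rewrite setTI.
have [PC0|PC0] := eqVneq (P C) 0.
  rewrite PC0 mul0e; apply/eqP; rewrite eq_le measure_ge0 andbT -PC0.
  apply: le_measure; [rewrite inE|by rewrite inE|by move=> t []].
  by apply: measurableI => //; exact: mVS.
have Pfin : P C \is a fin_num by exact: fin_num_measure.
pose p := fine (P C).
have pE : p%:E = P C by rewrite /p fineK.
have p0 : (0 < p)%R.
  by apply: fine_gt0; rewrite lt0e PC0 measure_ge0 /= ltey_eq Pfin.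
have pV : (0 <= p^-1)%R by rewrite invr_ge0 ltW.
pose kn : {nonneg R} := NngNum pV.
have Hu := @product_measure_unique _ _ _ _ R m1 m2 (mscale kn (pushforward (mrestr P mC) (fun t => (X t, Y t)))).
have E A : mscale kn (pushforward (mrestr P mC) (fun t => (X t, Y t))) A =
   p^-1%:E * P (C `&` [set t | A (X t, Y t)]).
  by rewrite /mscale /pushforward /mrestr /= setIC.
rewrite (Hu mV) //.
  transitivity (P C * (p^-1%:E * P (C `&` [set t | S (X t, Y t)]))); last by rewrite -(E mV S).
  by rewrite -[in RHS]pE muleA -EFinM mulfV ?gt_eqF // mul1e.
move=> A B mA mB; transitivity (p^-1%:E * P (C `&` [set t | (A `*` B) (X t, Y t)])); first exact: (E mV).
have -> : C `&` [set t | (A `*` B) (X t, Y t)] = C `&` (X @^-1` A `&` Y @^-1` B) by [].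
by rewrite H // -pE muleA -EFinM mulVf ?gt_eqF // mul1e.
Qed.

Variables (c h : R).
Hypotheses (c0 : (0 < c)%R) (h0 : (0 < h)%R).

(** [C] stands for all that must stay independent of the current step: departures already emitted,
    later increments, later queues. *)
Lemma step_indep (C : set T) (q b w : T -> R) : measurable C ->
  measurable_fun setT q -> measurable_fun setT b -> measurable_fun setT w ->
  (forall Aq Ab Aw, measurable Aq -> measurable Ab -> measurable Aw ->
    P (C `&` (q @^-1` Aq `&` (b @^-1` Ab `&` w @^-1` Aw))) =
    P C * (exp_law c0 Aq * (gauss_law h Ab * gauss_law h Aw))) ->
  forall A B, measurable A -> measurable B ->
    P (C `&` [set t | A (qstep c h (q t) (b t) (w t)) /\ B (dstep c h (q t) (b t) (w t))]) =
    P C * (exp_law c0 A * gauss_law h B).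
Proof.
move=> mC mq mb mw H A B mA mB.
have mpre (f : T -> R) (D : set R) : measurable_fun setT f -> measurable D -> measurable (f @^-1` D).
  by move=> mf mD; have := mf measurableT D mD; rewrite setTI.
have mwb : measurable_fun setT (fun t => (w t, b t) : measurableTypeR R * measurableTypeR R).
  exact: measurable_fun_pair.
(* The triple is assembled in two stages, following the nesting of [law3]: first [(w, b)], with the
   event on [q] absorbed into the conditioning event, then this pair with [q]. *)
have H2 (S : set (R * R)) (D : set R) : measurable S -> measurable D ->
    P (C `&` ((fun t => (w t, b t)) @^-1` S `&` q @^-1` D)) = P C * (law2 h S * exp_law c0 D).
  move=> mS mD.
  have mCq : measurable (C `&` q @^-1` D) by apply: measurableI => //; exact: mpre.
  have PCq : P (C `&` q @^-1` D) = P C * exp_law c0 D.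
    have := H D setT setT mD measurableT measurableT.
    by rewrite !preimage_setT !setIT probability_setT !mule1.
  have -> : C `&` ((fun t => (w t, b t)) @^-1` S `&` q @^-1` D) =
      (C `&` q @^-1` D) `&` [set t | S (w t, b t)].
    by rewrite (setIC _ (q @^-1` D)) setIA.
  rewrite (@pair_indep _ _ (measurableTypeR R) (measurableTypeR R) (gauss_law h) (gauss_law h)
     w b _ mCq mw mb _ S mS); first by rewrite PCq -muleA (muleC (exp_law c0 D)).
  move=> A1 A2 mA1 mA2; rewrite PCq -muleA (muleC (gauss_law h A1)) -(H D A2 A1) // -setIA.
  by rewrite (setIC (w @^-1` A1)).
have m1 : measurable_fun [set: R * R * R] (fun z => z.1.1).
  exact: (measurableT_comp measurable_fst measurable_fst).
have m2 : measurable_fun [set: R * R * R] (fun z => z.1.2).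
  exact: (measurableT_comp measurable_snd measurable_fst).
have m3 : measurable_fun [set: R * R * R] (fun z => z.2) by exact: measurable_snd.
have pA := measurable_qstep c h m3 m2 m1 measurableT mA.
have pB := measurable_dstep c h m3 m2 m1 measurableT mB.
rewrite setTI in pA; rewrite setTI in pB.
have key (S : set (R * R * R)) : measurable S ->
    P (C `&` [set t | S ((w t, b t), q t)]) = P C * law3 h c0 S.
  move=> mS; exact: (@pair_indep _ _ (measurableTypeR R * measurableTypeR R)%type (measurableTypeR R)
    (law2 h) (exp_law c0) _ _ _ mC mwb mq H2 S mS).
rewrite -(one_step c0 h0 mA mB).
have -> : [set z : R * R * R | A (qstep c h z.2 z.1.2 z.1.1) /\ B (dstep c h z.2 z.1.2 z.1.1)] =
  (fun z => qstep c h z.2 z.1.2 z.1.1) @^-1` A `&` (fun z => dstep c h z.2 z.1.2 z.1.1) @^-1` B.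
  by apply/seteqP; split.
rewrite -(key _ (measurableI _ _ pA pB)).
by congr (P _).
Qed.

Lemma measurable_qrec (q : T -> R) (b w : nat -> T -> R) j : measurable_fun setT q ->
  (forall j, measurable_fun setT (b j)) -> (forall j, measurable_fun setT (w j)) ->
  measurable_fun setT (fun t => qrec c h (q t) (b ^~ t) (w ^~ t) j).
Proof. by move=> mq mb mw; elim: j => //= j IH; exact: measurable_qstep. Qed.

Lemma measurable_dep (q : T -> R) (b w : nat -> T -> R) j : measurable_fun setT q ->
  (forall j, measurable_fun setT (b j)) -> (forall j, measurable_fun setT (w j)) ->
  measurable_fun setT (fun t => dep c h (b ^~ t) (w ^~ t) (q t) j).
Proof. by move=> mq mb mw; apply: measurable_dstep => //; exact: measurable_qrec. Qed.

Lemma measurable_dlayer (b : nat -> T -> R) (w : nat -> nat -> T -> R) (e : nat -> T -> R) n j :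
  (forall j, measurable_fun setT (b j)) -> (forall i j, measurable_fun setT (w i j)) ->
  (forall i, measurable_fun setT (e i)) ->
  measurable_fun setT (fun t => dlayer c h (b ^~ t) (fun i j => w i j t) (e ^~ t) n j).
Proof.
move=> mb mw me; elim: n j => [|n IH] j //=.
exact: (@measurable_dep (e n) (fun j t => dlayer c h (b^~ t) (fun i j => w i j t) (e^~ t) n j) (w n)).
Qed.

Definition cyl M (b : nat -> T -> R) (A : nat -> set R) : set T :=
  [set t | forall j, (j < M)%N -> A j (b j t)].

Lemma measurable_cyl M b A : (forall j, measurable_fun setT (b j)) ->
  (forall j, measurable (A j)) -> measurable (cyl M b A).
Proof.
move=> mb mA; rewrite (_ : cyl M b A = \bigcap_(j in [set j | (j < M)%N]) (b j @^-1` A j)) //.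
apply: bigcap_measurableType => // j _.
by have := mb j measurableT (A j) (mA j); rewrite setTI.
Qed.

Lemma cyl0 b A : cyl 0 b A = setT.
Proof. by apply/seteqP; split. Qed.

Lemma cylT M b : cyl M b (fun=> setT) = setT.
Proof. by apply/seteqP; split. Qed.

Lemma cylS M b A : cyl M.+1 b A =
  b 0%N @^-1` A 0%N `&` cyl M (fun j => b j.+1) (fun j => A j.+1).
Proof.
apply/seteqP; split=> t /=; first by move=> H; split=> [|j jM]; exact: H.
by move=> [H0 H] [|j] // jM; exact: H.
Qed.

Definition gprod M (A : nat -> set R) : \bar R := \big[*%E/1]_(j < M) gauss_law h (A j).

Lemma gprodS M A : gprod M.+1 A = gauss_law h (A 0%N) * gprod M (fun j => A j.+1).
Proof. by rewrite /gprod big_ord_recl. Qed.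

Lemma gprodT M : gprod M (fun=> setT) = 1.
Proof. by rewrite /gprod big1 // => j _; rewrite probability_setT. Qed.

(** Induction on time. After one step the new queue is exponential and independent of the first
    departure, of the increments to come and of [C]; the first departure then moves into [C], and
    the shifted data satisfy the same hypothesis. *)
Lemma layer_indep M (C : set T) (q : T -> R) (b w : nat -> T -> R) :
  measurable C -> measurable_fun setT q ->
  (forall j, measurable_fun setT (b j)) -> (forall j, measurable_fun setT (w j)) ->
  (forall Aq Ab Aw, measurable Aq -> (forall j, measurable (Ab j)) -> (forall j, measurable (Aw j)) ->
    P (C `&` (q @^-1` Aq `&` (cyl M b Ab `&` cyl M w Aw))) =
    P C * (exp_law c0 Aq * (gprod M Ab * gprod M Aw))) ->
  forall B, (forall j, measurable (B j)) ->
  P (C `&` cyl M (fun j t => dep c h (b ^~ t) (w ^~ t) (q t) j) B) = P C * gprod M B.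
Proof.
elim: M C q b w => [|M IH] C q b w mC mq mb mw H B mB.
  by rewrite cyl0 setIT /gprod big_ord0 mule1.
pose q' t := qstep c h (q t) (b 0%N t) (w 0%N t).
pose d0 t := dstep c h (q t) (b 0%N t) (w 0%N t).
have mpre (f : T -> R) (D : set R) : measurable_fun setT f -> measurable D -> measurable (f @^-1` D).
  by move=> mf mD; have := mf measurableT D mD; rewrite setTI.
have mq' : measurable_fun setT q' by exact: measurable_qstep.
have md0 : measurable_fun setT d0 by exact: measurable_dstep.
(* The later increments join the conditioning event, which leaves a single step for [step_indep]. *)
have HS Aq Ab Aw : measurable Aq -> (forall j, measurable (Ab j)) -> (forall j, measurable (Aw j)) ->
    P (C `&` (cyl M (fun j => b j.+1) Ab `&` cyl M (fun j => w j.+1) Aw) `&`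
      [set t | Aq (q' t) /\ B 0%N (d0 t)]) =
    P C * (gprod M Ab * gprod M Aw) * (exp_law c0 Aq * gauss_law h (B 0%N)).
  move=> mAq mAb mAw.
  have mC' : measurable (C `&` (cyl M (fun j => b j.+1) Ab `&` cyl M (fun j => w j.+1) Aw)).
    by apply: measurableI => //; apply: measurableI; exact: measurable_cyl.
  have G Aq' Ab' Aw' : measurable Aq' -> measurable Ab' -> measurable Aw' ->
      P (C `&` (cyl M (fun j => b j.+1) Ab `&` cyl M (fun j => w j.+1) Aw) `&`
        (q @^-1` Aq' `&` (b 0%N @^-1` Ab' `&` w 0%N @^-1` Aw'))) =
      P C * (exp_law c0 Aq' * (gauss_law h Ab' * gprod M Ab * (gauss_law h Aw' * gprod M Aw))).
    move=> mAq' mAb' mAw'.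
    pose Ab1 j := if j is j.+1 then Ab j else Ab'.
    pose Aw1 j := if j is j.+1 then Aw j else Aw'.
    have := H Aq' Ab1 Aw1 mAq'; rewrite !gprodS => <-; last 2 first.
    - by case.
    - by case.
    by congr (P _); rewrite !cylS; apply/seteqP; split=> t /=; tauto.
  have PC' : P (C `&` (cyl M (fun j => b j.+1) Ab `&` cyl M (fun j => w j.+1) Aw)) =
      P C * (gprod M Ab * gprod M Aw).
    by have := G setT setT setT measurableT measurableT measurableT; rewrite !preimage_setT !setIT !probability_setT !mul1e.
  rewrite (step_indep mC' mq (mb 0%N) (mw 0%N) _ mAq (mB 0%N)) ?PC' //.
  move=> Aq' Ab' Aw' mAq' mAb' mAw'; rewrite G // -[RHS]muleA; congr (_ * _).
  rewrite [RHS]muleCA; congr (_ * _).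
  by rewrite muleACA muleC.
have PC0 : P (C `&` d0 @^-1` B 0%N) = P C * gauss_law h (B 0%N).
  have := HS setT (fun=> setT) (fun=> setT) measurableT (fun=> measurableT) (fun=> measurableT).
  rewrite !cylT !gprodT !setIT probability_setT !mule1 mul1e => <-.
  by congr (P _); apply/seteqP; split=> t /=; tauto.
have mC0 : measurable (C `&` d0 @^-1` B 0%N) by apply: measurableI => //; exact: mpre.
rewrite cylS gprodS setIA.
have -> : (fun t => dep c h (b^~ t) (w^~ t) (q t) 0%N) = d0 by [].
have -> : (fun j t => dep c h (b^~ t) (w^~ t) (q t) j.+1) =
   (fun j t => dep c h ((fun j => b j.+1) ^~ t) ((fun j => w j.+1) ^~ t) (q' t) j).
  by apply/funext => j; apply/funext => t; rewrite dep_front.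
rewrite (IH _ q') //; first by rewrite PC0 muleA.
move=> Aq Ab Aw mAq mAb mAw; rewrite PC0.
transitivity (P (C `&` (cyl M (fun j => b j.+1) Ab `&` cyl M (fun j => w j.+1) Aw) `&`
      [set t | Aq (q' t) /\ B 0%N (d0 t)])).
  by congr (P _); apply/seteqP; split=> t /=; tauto.
rewrite HS // -!muleA; congr (_ * _).
by rewrite muleA muleC -muleA muleCA; congr (_ * _).
Qed.

Definition evt n M (w : nat -> nat -> T -> R) (e : nat -> T -> R)
  (Aw : nat -> nat -> set R) (Ae : nat -> set R) : set T :=
  [set t | forall i, (i < n)%N -> Ae i (e i t) /\ cyl M (w i) (Aw i) t].

Definition eprod n M (Aw : nat -> nat -> set R) (Ae : nat -> set R) : \bar R :=
  \big[*%E/1]_(i < n) (exp_law c0 (Ae i) * gprod M (Aw i)).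

Lemma measurable_evt n M w e Aw Ae : (forall i j, measurable_fun setT (w i j)) ->
  (forall i, measurable_fun setT (e i)) -> (forall i j, measurable (Aw i j)) ->
  (forall i, measurable (Ae i)) -> measurable (evt n M w e Aw Ae).
Proof.
move=> mw me mAw mAe.
rewrite (_ : evt n M w e Aw Ae =
  \bigcap_(i in [set i | (i < n)%N]) (e i @^-1` Ae i `&` cyl M (w i) (Aw i))) //.
apply: bigcap_measurableType => // i _; apply: measurableI; last exact: measurable_cyl.
by have := me i measurableT (Ae i) (mAe i); rewrite setTI.
Qed.

Lemma evtS n M w e Aw Ae : evt n.+1 M w e Aw Ae =
  (e 0%N @^-1` Ae 0%N `&` cyl M (w 0%N) (Aw 0%N)) `&`
  evt n M (fun i => w i.+1) (fun i => e i.+1) (fun i => Aw i.+1) (fun i => Ae i.+1).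
Proof.
apply/seteqP; split=> t /=; first by move=> H; split=> [|i im]; exact: H.
by move=> [H0 H] [|i] // im; exact: H.
Qed.

Lemma eprodS n M Aw Ae : eprod n.+1 M Aw Ae =
  exp_law c0 (Ae 0%N) * gprod M (Aw 0%N) * eprod n M (fun i => Aw i.+1) (fun i => Ae i.+1).
Proof. by rewrite /eprod big_ord_recl. Qed.

Definition tandem_indep n M (b : nat -> T -> R) w e := forall Ab Aw Ae,
  (forall j, measurable (Ab j)) -> (forall i j, measurable (Aw i j)) -> (forall i, measurable (Ae i)) ->
  P (cyl M b Ab `&` evt n M w e Aw Ae) = gprod M Ab * eprod n M Aw Ae.

Lemma tandem_law n M (b : nat -> T -> R) w e :
  (forall j, measurable_fun setT (b j)) -> (forall i j, measurable_fun setT (w i j)) ->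
  (forall i, measurable_fun setT (e i)) -> tandem_indep n M b w e ->
  forall B, (forall j, measurable (B j)) ->
  P (cyl M (fun j t => dlayer c h (b ^~ t) (fun i j => w i j t) (e ^~ t) n j) B) = gprod M B.
Proof.
elim: n b w e => [|n IH] b w e mb mw me H B mB.
  have := H B (fun _ _ => setT) (fun=> setT) mB (fun _ _ => measurableT) (fun=> measurableT).
  rewrite /eprod big_ord0 mule1 => <-; congr (P _); rewrite [X in _ `&` X](_ : _ = setT) ?setIT //.
  by apply/seteqP; split.
have -> : (fun j t => dlayer c h (b^~ t) (fun i j => w i j t) (e^~ t) n.+1 j) =
  (fun j t => dlayer c h ((fun j t => dep c h (b ^~ t) (w 0%N ^~ t) (e 0%N t) j) ^~ t)
     (fun i j => w i.+1 j t) ((fun i => e i.+1) ^~ t) n j).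
  by apply/funext => j; apply/funext => t; rewrite dlayer_front.
apply: (IH _ (fun i => w i.+1) (fun i => e i.+1)) => //; first by move=> j; exact: measurable_dep.
move=> Ab Aw Ae mAb mAw mAe.
have mC : measurable (evt n M (fun i => w i.+1) (fun i => e i.+1) Aw Ae) by exact: measurable_evt.
have G Aq Ab' Aw' : measurable Aq -> (forall j, measurable (Ab' j)) -> (forall j, measurable (Aw' j)) ->
    P (evt n M (fun i => w i.+1) (fun i => e i.+1) Aw Ae `&`
       (e 0%N @^-1` Aq `&` (cyl M b Ab' `&` cyl M (w 0%N) Aw'))) =
    eprod n M Aw Ae * (exp_law c0 Aq * (gprod M Ab' * gprod M Aw')).
  move=> mAq mAb' mAw'.
  pose Aw1 i := if i is i.+1 then Aw i else Aw'.
  pose Ae1 i := if i is i.+1 then Ae i else Aq.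
  have := H Ab' Aw1 Ae1 mAb'; rewrite eprodS => H'.
  transitivity (gprod M Ab' * (exp_law c0 Aq * gprod M Aw' * eprod n M Aw Ae)).
    rewrite -H'; [|by case|by case].
    by rewrite evtS; congr (P _); apply/seteqP; split=> t /=; tauto.
  by rewrite muleA muleC; congr (_ * _); rewrite muleCA.
have PC : P (evt n M (fun i => w i.+1) (fun i => e i.+1) Aw Ae) = eprod n M Aw Ae.
  have := G setT (fun=> setT) (fun=> setT) measurableT (fun=> measurableT) (fun=> measurableT).
  by rewrite preimage_setT !cylT !setIT !gprodT probability_setT !mule1.
rewrite setIC muleC -PC; apply: layer_indep => //.
by move=> Aq Ab' Aw' mAq mAb' mAw'; rewrite G // PC.
Qed.

End independence.

(** * Expectations and laws of the layers *)

Section null_sets.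
Context {R : realType} {d} {T : measurableType d} (P : {measure set T -> \bar R}).
Local Open Scope ereal_scope.
Import HBNNSimple.

(** [f] may fail to be measurable, since on the null set a path is arbitrary. The integral is
    therefore handled as a supremum over simple functions below [f]: multiplying one by the
    indicator of the complement of [N] keeps its integral and puts it below the restriction. *)
Lemma ge0_integral_null (f : T -> \bar R) (N : set T) : (forall x, 0 <= f x) ->
  measurable N -> P N = 0 -> \int[P]_x f x = \int[P]_x (f \_ (~` N)) x.
Proof.
move=> f0 mN PN; have mNc : measurable (~` N) by exact: measurableC.
have g0 x : 0 <= (f \_ (~` N)) x by rewrite patchE; case: ifP.
apply/eqP; rewrite eq_le; apply/andP; split; last first.
  rewrite !ge0_integralTE //; apply/ereal_supP => _ [k /= kf <-].
  apply: ereal_sup_ubound; exists k => //= x.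
  by apply: le_trans (kf x) _; rewrite patchE; case: ifP.
rewrite [leLHS]ge0_integralTE //; apply/ereal_supP => _ [k /= kf <-].
rewrite [leRHS]ge0_integralTE //; apply: ereal_sup_ubound.
exists (mul_nnsfun k (indic_nnsfun R mNc)) => [x|]; last first.
  rewrite -!integralT_nnsfun; apply: ge0_ae_eq_integral => //.
  - exact/measurable_EFinP.
  - exact/measurable_EFinP.
  - by move=> x _; rewrite lee_fin.
  - by move=> x _; rewrite lee_fin.
  exists N; split => // x /= /not_implyP[_]; apply: contra_notP => Nx.
  by rewrite mindicE mem_set // mulr1.
rewrite /= mindicE patchE; case: ifPn => xN; first by rewrite mulr1.
by rewrite mulr0.
Qed.

Lemma integral_null (f : T -> \bar R) (N : set T) :
  measurable N -> P N = 0 -> \int[P]_x f x = \int[P]_x (f \_ (~` N)) x.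
Proof.
move=> mN PN; rewrite integralE [RHS]integralE funepos_restrict funeneg_restrict.
by congr (_ - _); apply: ge0_integral_null.
Qed.

Lemma eq_integral_null (f g : T -> \bar R) (N : set T) :
  measurable N -> P N = 0 -> (forall x, ~ N x -> f x = g x) -> \int[P]_x f x = \int[P]_x g x.
Proof.
move=> mN PN fg; rewrite (integral_null f mN PN) (integral_null g mN PN).
by apply: eq_integral => x _; rewrite !patchE; case: ifPn => // /[!inE] /fg.
Qed.

End null_sets.

Section expectation.
Context {R : realType} {d} {T : measurableType d} (P : probability T R).

Definition bmfun (F : T -> R) (M : R) := measurable_fun setT F /\ forall w, `|F w| <= M.

Lemma bmfun_integrable F M : bmfun F M -> P.-integrable setT (EFin \o F).
Proof.
move=> [mF bF]; apply: measurable_bounded_integrable => //.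
  by apply: le_lt_trans (probability_le1 P measurableT) _; rewrite ltry.
exists M; split; first exact: num_real.
by move=> x Mx w _; exact: le_trans (ltW Mx).
Qed.

Lemma expect_fin F M : bmfun F M -> (\int[P]_w (F w)%:E)%E = (\int[P]_w F w)%:E.
Proof. by move=> /bmfun_integrable H; rewrite /Rintegral fineK //; exact: integrable_fin_num. Qed.

Lemma expect_le F G M M' : bmfun F M -> bmfun G M' -> (forall w, F w <= G w) ->
  \int[P]_w F w <= \int[P]_w G w.
Proof.
by move=> /bmfun_integrable iF /bmfun_integrable iG FG; apply: le_Rintegral.
Qed.

Lemma expectD F G M M' : bmfun F M -> bmfun G M' ->
  \int[P]_w (F w + G w) = \int[P]_w F w + \int[P]_w G w.
Proof. by move=> /bmfun_integrable iF /bmfun_integrable iG; apply: RintegralD. Qed.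

Lemma expectZ F M r : bmfun F M -> \int[P]_w (r * F w) = r * \int[P]_w F w.
Proof. by move=> /bmfun_integrable iF; apply: RintegralZl. Qed.

Lemma bmfun_cvg (F : nat -> T -> R) G M : (forall n, bmfun (F n) M) ->
  (forall w, F n w @[n --> \oo] --> G w) -> bmfun G M.
Proof.
move=> bF FG; split=> [|w].
  by apply: (measurable_fun_cvg (h := F)) => [n|w _]; [have [] := bF n|exact: FG].
have H : `|F n w| @[n --> \oo] --> `|G w| by apply: cvg_norm; exact: FG.
rewrite -(cvg_lim _ H) //.
by apply: limr_le; [exact: cvgP H|apply: nearW => n; exact: (bF n).2].
Qed.

Lemma expect_cvg (F : nat -> T -> R) G M : (forall n, bmfun (F n) M) ->
  (forall w, F n w @[n --> \oo] --> G w) ->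
  (\int[P]_w F n w) @[n --> \oo] --> \int[P]_w G w.
Proof.
move=> bF FG; have bG := bmfun_cvg bF FG.
have [|||||] := @dominated_convergence _ T R P setT measurableT (fun n => EFin \o F n)
  (EFin \o G) (cst M%:E).
- by move=> n; apply/measurable_EFinP; have [] := bF n.
- by apply/measurable_EFinP; have [] := bG.
- by apply: aeW => w _; apply: cvg_EFin; [exact: nearW|exact: FG].
- exact: finite_measure_integrable_cst.
- by apply: aeW => w n _; rewrite lee_fin; exact: (bF n).2.
move=> _ _ /=.
under eq_fun do rewrite (expect_fin (bF _)).
by rewrite (expect_fin bG) => /fine_cvgP[_].
Qed.

End expectation.

Section discrete_law.
Context {R : realType}.

(** A law on the natural numbers is determined by its atoms, and every function on them is
    measurable; two different probability spaces are compared here. *)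
Lemma integral_nat_law {d d'} {T : measurableType d} {T' : measurableType d'}
  (P : probability T R) (P' : probability T' R) (X : T -> nat) (X' : T' -> nat) :
  measurable_fun setT X -> measurable_fun setT X' ->
  (forall k, P (X @^-1` [set k]) = P' (X' @^-1` [set k])) ->
  forall (g : nat -> R) M, (forall k, `|g k| <= M) ->
  \int[P]_w g (X w) = \int[P']_w g (X' w).
Proof.
move=> mX mX' H g M gM.
have mg : measurable_fun setT g by [].
have ipush d0 (T0 : measurableType d0) (P0 : probability T0 R) (X0 : T0 -> nat)
    (mX0 : measurable_fun setT X0) :
    (\int[P0]_w (g (X0 w))%:E = \int[pushforward P0 X0]_k (g k)%:E)%E.
  rewrite (integral_pushforward mX0 (f := fun k => (g k)%:E)) //.
  by apply: (@bmfun_integrable _ _ _ P0 (g \o X0) M); split=> [|w]; [exact: (measurableT_comp mg mX0)|exact: gM].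
rewrite /Rintegral; congr fine; rewrite (ipush _ _ P X mX) (ipush _ _ P' X' mX').
apply: eq_measure_integral => A _ _.
have dec d0 (T0 : measurableType d0) (P0 : probability T0 R) (X0 : T0 -> nat)
    (mX0 : measurable_fun setT X0) :
    P0 (X0 @^-1` A) = (\sum_(0 <= k <oo | k \in A) P0 (X0 @^-1` [set k]))%E.
  rewrite -measure_bigcup.
  - congr (P0 _); apply/seteqP; split=> w /=; first by move=> Aw; exists (X0 w).
    by move=> [k Ak /= ->].
  - by move=> k _; have := mX0 measurableT [set k] I; rewrite setTI; apply.
  - by move=> i j _ _ [w [/= -> ->]].
transitivity (P (X @^-1` A)); first by [].
transitivity (P' (X' @^-1` A)); last by [].
rewrite (dec _ _ P X mX) (dec _ _ P' X' mX').
by apply: eq_eseriesr => k _; exact: H.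
Qed.

End discrete_law.

(** * Codes of rounded paths and their events *)

Section coding.
Context {R : realType}.

Definition cell N (k j : nat) : set R :=
  [set x | Num.floor (x / etaN N) = nth 0 (odflt [::] (unpickle k) : seq int) j].

(** Singles out the codes of lists of length exactly [MN N]: only these return to [k] when read back
    through the default values and encoded again. *)
Definition valid N (k : nat) : bool :=
  pickle (mkseq (nth 0 (odflt [::] (unpickle k) : seq int)) (MN N)) == k.

Lemma measurable_cell N k j : measurable (cell N k j).
Proof.
rewrite /cell; move: (nth _ _ _) => z.
rewrite (_ : [set x | _] = `[z%:~R * etaN N, (z + 1)%:~R * etaN N[%classic).
  exact: measurable_itv.
apply/seteqP; split=> x /=; rewrite in_itv /= -ler_pdivlMr ?etaN_gt0 // -ltr_pdivrMr ?etaN_gt0 //.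
  by move=> <-; apply: real_floor_itv; exact: num_real.
by move=> H; apply: floor_def.
Qed.

Context {d} {T : measurableType d}.
Implicit Types b : nat -> T -> R.

(** [pickle] is injective, so fixing the code fixes every rounded increment; the event is a
    cylinder, whose probability a grid law prescribes. *)
Lemma code_eq N b k :
  [set t | code N (b ^~ t) = k] = if valid N k then cyl (MN N) b (cell N k) else set0.
Proof.
have codeE t : code N (b ^~ t) = pickle (mkseq (fun j => Num.floor (b j t / etaN N)) (MN N)) by [].
apply/seteqP; split=> t /=.
  rewrite codeE => ck.
  have uk : unpickle k = Some (mkseq (fun j => Num.floor (b j t / etaN N)) (MN N)).
    by rewrite -ck pickleK.
  have -> : valid N k.
    rewrite /valid uk /odflt /oapp -[X in _ == X]ck; apply/eqP; congr pickle.
    apply: (@eq_from_nth _ 0); rewrite !size_mkseq // => i iM.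
   by rewrite nth_mkseq //.
  move=> j jM; rewrite /cell; change (Num.floor (b j t / etaN N) =
    nth 0 (odflt [::] (unpickle k) : seq int) j).
  by rewrite uk /odflt /oapp nth_mkseq.
case: ifP => // /eqP vk H; rewrite codeE -[RHS]vk; congr pickle.
apply: (@eq_from_nth _ 0); rewrite !size_mkseq // => i iM.
by rewrite !nth_mkseq //; exact: H.
Qed.

Lemma measurable_code N b : (forall j, measurable_fun setT (b j)) ->
  measurable_fun setT (fun t => code N (b ^~ t)).
Proof.
move=> mb _ Y _; rewrite setTI.
rewrite (_ : _ @^-1` Y = \bigcup_(k in Y) [set t | code N (b ^~ t) = k]); last first.
  by apply/seteqP; split=> t /=; [move=> Yt; exists (code N (b ^~ t))|move=> [k Yk /= ->]].
apply: bigcup_measurable => k _; rewrite code_eq; case: ifP => // _.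
by apply: measurable_cyl => // j; exact: measurable_cell.
Qed.

End coding.

(** * Equality of expectations from equality of grid laws *)

Section laws.
Context {R : realType}.

Definition grid_law {d} {T : measurableType d} (P : probability T R) h M (b : nat -> T -> R) :=
  forall B, (forall j, measurable (B j)) -> P (cyl M b B) = gprod h M B.

Lemma expect_code_eq {d d'} {T : measurableType d} {T' : measurableType d'}
  (P : probability T R) (P' : probability T' R) N b b' :
  (forall j, measurable_fun setT (b j)) -> (forall j, measurable_fun setT (b' j)) ->
  grid_law P (hN N) (MN N) b -> grid_law P' (hN N) (MN N) b' ->
  forall (g : nat -> R) M, (forall k, `|g k| <= M) ->
  \int[P]_w g (code N (b ^~ w)) = \int[P']_w g (code N (b' ^~ w)).
Proof.
move=> mb mb' L L' g M gM.
apply: (integral_nat_law (measurable_code N mb) (measurable_code N mb') _ gM).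
move=> k; transitivity (P [set t | code N (b ^~ t) = k]); first by [].
transitivity (P' [set t | code N (b' ^~ t) = k]); last by [].
rewrite !code_eq; case: ifP => _; last by rewrite !measure0.
by rewrite L ?L' // => j; exact: measurable_cell.
Qed.

(** Path properties at every sample point rather than almost surely; the data are brought to this
    form by [kill]. *)
Definition good_proc {d} {T : measurableType d} (X : T -> R -> R) :=
  is_process X /\ forall t, lucont (X t) /\ X t 0 = 0.

Lemma measurable_incr {d} {T : measurableType d} (X : T -> R -> R) h j : 0 <= h ->
  is_process X -> measurable_fun setT (fun t => incr h (X t) j).
Proof.
move=> h0 mX; apply: measurable_funB; apply: mX; exact: mulr_ge0.
Qed.

Section layers.
Context {d} {T : measurableType d}.
Variables (x : T -> R -> R) (w : nat -> T -> R -> R) (e : nat -> T -> R).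
Hypotheses (gx : good_proc x) (gw : forall i, good_proc (w i))
  (me : forall i, measurable_fun setT (e i)) (e0 : forall i t, 0 <= e i t).

Definition layerT c n t : R -> R := layer c (x t) (w ^~ t) (e ^~ t) n.

Lemma lucont_layerT c n t : lucont (layerT c n t).
Proof. by apply: lucont_layer; [exact: (gx.2 t).1|move=> k; exact: ((gw k).2 t).1]. Qed.


Definition dincr c n N j t : R := dlayer c (hN N) (incr (hN N) (x t))
  (fun i => incr (hN N) (w i t)) (e ^~ t) n j.

Lemma measurable_dincr c n N j : measurable_fun setT (dincr c n N j).
Proof.
have h0 : 0 <= hN N :> R by exact: ltW (hN_gt0 N).
apply: (@measurable_dlayer _ _ _ c (hN N) (fun j t => incr (hN N) (x t) j)
  (fun i j t => incr (hN N) (w i t) j) e n j) => //.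
  by move=> k; apply: measurable_incr => //; exact: gx.1.
by move=> i k; apply: measurable_incr => //; exact: (gw i).1.
Qed.

Lemma layerT_cvg c n f t : bounded_cont_functional f ->
  f (decode N (code N (dincr c n N ^~ t))) @[N --> \oo] --> f (layerT c n t).
Proof.
move=> bf; apply: (bcf_cvg bf); first by move=> k; exact: lucont_decode.
- exact: lucont_layerT.
by apply: approx_cvg => //; do ?[exact: (gx.2 t).1 | exact: (gx.2 t).2
  | move=> k; exact: ((gw k).2 t).1 | move=> k; exact: ((gw k).2 t).2].
Qed.

(** Along a layer [f] is the pointwise limit of functions of a natural number, which is where its
    measurability comes from. *)
Lemma bmfun_layerT c n f M : bounded_cont_functional f -> (forall g, `|f g| <= M) ->
  bmfun (fun t => f (layerT c n t)) M.
Proof.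
move=> bf fM; apply: (@bmfun_cvg _ _ _ (fun N t => f (decode N (code N (dincr c n N ^~ t))))).
  move=> N; split=> [|t]; last exact: fM.
  by apply: (measurableT_comp (f := fun k : nat => f (decode N k))) => //;
    apply: measurable_code => j; exact: measurable_dincr.
by move=> t; exact: layerT_cvg.
Qed.

End layers.

(** At each mesh the expectations over coded paths coincide, and both sides converge by dominated
    convergence. With [n' = 0] the right side is a plain process, so the grid computation carries
    over to Brownian motion. *)
Lemma expect_layerT_eq {d d'} {T : measurableType d} {T' : measurableType d'}
  (P : probability T R) (P' : probability T' R)
  (x : T -> R -> R) (w : nat -> T -> R -> R) (e : nat -> T -> R)
  (x' : T' -> R -> R) (w' : nat -> T' -> R -> R) (e' : nat -> T' -> R) c c' n n' f :
  good_proc x -> (forall i, good_proc (w i)) -> (forall i, measurable_fun setT (e i)) ->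
  (forall i t, 0 <= e i t) ->
  good_proc x' -> (forall i, good_proc (w' i)) -> (forall i, measurable_fun setT (e' i)) ->
  (forall i t, 0 <= e' i t) ->
  (forall N, grid_law P (hN N) (MN N) (dincr x w e c n N)) ->
  (forall N, grid_law P' (hN N) (MN N) (dincr x' w' e' c' n' N)) ->
  bounded_cont_functional f ->
  \int[P]_t f (layerT x w e c n t) = \int[P']_t f (layerT x' w' e' c' n' t).
Proof.
move=> gx gw me e0 gx' gw' me' e0' L L' bf; have [[M fM] _] := bf.
have bmN d0 (T0 : measurableType d0) (x0 : T0 -> R -> R) w0 e00 c0 n0
    (g0 : good_proc x0) (g1 : forall i, good_proc (w0 i)) (g2 : forall i, measurable_fun setT (e00 i)) N :
    bmfun (fun t => f (decode N (code N (dincr x0 w0 e00 c0 n0 N ^~ t)))) M.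
  split=> [|t]; last exact: fM.
  by apply: (measurableT_comp (f := fun k : nat => f (decode N k))) => //;
    apply: measurable_code => j; exact: measurable_dincr.
have C1 := expect_cvg (P := P) (bmN _ _ x w e c n gx gw me) (fun t => @layerT_cvg _ _ x w e gx gw e0 c n f t bf).
have C2 := expect_cvg (P := P') (bmN _ _ x' w' e' c' n' gx' gw' me') (fun t => @layerT_cvg _ _ x' w' e' gx' gw' e0' c' n' f t bf).
apply: cvg_unique C1 _ => //.
rewrite (_ : (fun N => _) = (fun N => \int[P']_t f (decode N (code N (dincr x' w' e' c' n' N ^~ t))))) //.
apply/funext => N.
by apply: (expect_code_eq _ _ (L N) (L' N) (g := fun k => f (decode N k)) (M := M)) => // j; exact: measurable_dincr.
Qed.

End laws.

(** * Lipschitz functionals and coupling *)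

Section functionals.
Context {R : realType}.
Implicit Types (x y z : R -> R) (Tm r : R).

Definition snorm Tm x := sup [set `|x t| | t in `[0, Tm]].

Lemma snorm_ge0 Tm x : 0 <= snorm Tm x.
Proof.
rewrite /snorm; set S := [set _ | _ in _].
(* For an empty or unbounded set [sup] takes the default value [0]. *)
have [[[v Sv] ubS]|hs] := pselect (has_sup S); last by rewrite sup_out.
apply: le_trans (ub_le_sup ubS Sv); case: Sv => t _ <-; exact: normr_ge0.
Qed.

Lemma snorm_ub Tm x t : lucont x -> 0 <= t <= Tm -> `|x t| <= snorm Tm x.
Proof.
move=> ux tT; apply: ub_le_sup; last by exists t => //=; rewrite in_itv.
have [K _ hK] := lucont_bounded Tm ux.
by exists K => _ [u /= + <-]; rewrite in_itv /=; exact: hK.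
Qed.

Lemma snorm_le Tm x r : 0 <= r -> (forall t, 0 <= t <= Tm -> `|x t| <= r) -> snorm Tm x <= r.
Proof.
move=> r0 H; have [T0|T0] := leP 0 Tm.
  apply: ge_sup; first by exists `|x 0|, 0 => //=; rewrite in_itv /= lexx.
  by move=> _ [u /= + <-]; rewrite in_itv /=; exact: H.
rewrite /snorm (_ : [set _ | _ in _] = set0) ?sup0 //.
apply/seteqP; split=> // _ [u /= + _]; rewrite in_itv /= => /andP[u0 uT].
by have := le_lt_trans (le_trans u0 uT) T0; rewrite ltxx.
Qed.

Lemma lucontB x y : lucont x -> lucont y -> lucont (fun t => x t - y t).
Proof. by move=> ux uy; apply: lucontD => //; exact: lucontN. Qed.

Lemma snormD Tm x y : lucont x -> lucont y -> snorm Tm (fun t => x t + y t) <= snorm Tm x + snorm Tm y.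
Proof.
move=> ux uy; apply: snorm_le; first by rewrite addr_ge0 // snorm_ge0.
by move=> t tT; apply: le_trans (ler_normD _ _) _; apply: lerD; exact: snorm_ub.
Qed.

Lemma snorm_distC Tm x y : snorm Tm (fun t => x t - y t) = snorm Tm (fun t => y t - x t).
Proof. by rewrite /snorm; congr sup; apply/seteqP; split=> _ [t tT <-]; exists t => //; rewrite distrC. Qed.

Lemma snorm_lip Tm x y : lucont x -> lucont y ->
  `|snorm Tm x - snorm Tm y| <= snorm Tm (fun t => x t - y t).
Proof.
have main u v : lucont u -> lucont v -> snorm Tm u <= snorm Tm v + snorm Tm (fun t => u t - v t).
  move=> uu uv; apply: le_trans (snormD _ uv (lucontB uu uv)).
  by apply: snorm_le => [|t tT]; [exact: snorm_ge0|
     rewrite -[u t](subrKC (v t)); apply: (snorm_ub (x := fun t => v t + (u t - v t))) => //;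
     apply: lucontD => //; exact: lucontB].
move=> ux uy; rewrite ler_distl; apply/andP; split.
  by rewrite lerBlDr snorm_distC; exact: main.
exact: main.
Qed.

(* Functionals are compared on continuous paths only, so any Lipschitz bound
   for [snorm] gives continuity. *)
Lemma lip_bcf (f : (R -> R) -> R) Tm (K M : R) : 0 <= Tm -> 0 <= K -> (forall x, `|f x| <= M) ->
  (forall x y, lucont x -> lucont y -> `|f x - f y| <= K * snorm Tm (fun t => x t - y t)) ->
  bounded_cont_functional f.
Proof.
move=> T0 K0 fM fL; split; first by exists M.
move=> gs g /(_ _)/cont_path_lucont ugs /cont_path_lucont ug H.
apply/cvgrPdist_le => e e0.
have eK : 0 < e / (K + 1) by rewrite divr_gt0 // ltr_wpDl.
have /cvgrPdist_le/(_ _ eK)[n0 _ Hn] := H Tm T0; exists n0 => // n /Hn.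
rewrite sub0r normrN => Hs; rewrite distrC; apply: le_trans (fL _ _ (ugs n) ug) _.
have Hs' : snorm Tm (fun t => gs n t - g t) <= e / (K + 1) by exact: le_trans (ler_norm _) Hs.
apply: le_trans (_ : (K + 1) * snorm Tm (fun t => gs n t - g t) <= _).
  by rewrite ler_wpM2r ?snorm_ge0 // lerDl.
by rewrite mulrC -ler_pdivlMr // ltr_wpDl.
Qed.

(** A continuous stand-in for the indicator of [r <= snorm Tm x]: equality of laws is available in
    terms of bounded continuous functionals. *)
Definition cap Tm r x := Num.min 1 (snorm Tm x / r).

Lemma cap_ge0 Tm r x : 0 <= r -> 0 <= cap Tm r x.
Proof. by move=> r0; rewrite le_min ler01 divr_ge0 // snorm_ge0. Qed.

Lemma cap_norm Tm r x : 0 <= r -> `|cap Tm r x| <= 1.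
Proof. by move=> r0; rewrite ger0_norm ?cap_ge0 // ge_min lexx. Qed.

Lemma cap_lt1 Tm r x : 0 < r -> cap Tm r x < 1 -> snorm Tm x < r.
Proof. by move=> r0; rewrite gt_min ltxx /= ltr_pdivrMr // mul1r. Qed.

Lemma bcf_cap Tm r : 0 <= Tm -> 0 < r -> bounded_cont_functional (cap Tm r).
Proof.
move=> T0 r0; apply: (@lip_bcf _ Tm r^-1 1) => //; first by rewrite invr_ge0 ltW.
  by move=> x; apply: cap_norm; exact: ltW.
move=> x y ux uy; apply: le_trans (_ : `|snorm Tm x / r - snorm Tm y / r| <= _).
  rewrite /cap; move: (snorm Tm x / r) (snorm Tm y / r) => u v.
  have h1 := ler_norm (u - v); have h2 := ler_norm (v - u); rewrite distrC in h2.
  have h0 := normr_ge0 (u - v).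
  rewrite ler_norml !minEle; move: (`|u - v|) h0 h1 h2 => D h0 h1 h2.
  by case: (leP 1 u) => ?; case: (leP 1 v) => ?; lra.
by rewrite -mulrBl normrM [X in _ * X]gtr0_norm ?invr_gt0 // mulrC ler_pM2l ?invr_gt0 // snorm_lip.
Qed.

Lemma cap_cvg0 Tm x : cap Tm n.+1%:R x @[n --> \oo] --> (0 : R).
Proof.
apply/cvgrPdist_le => e e0; exists (Num.truncn (snorm Tm x / e)) => // n /= nn.
rewrite sub0r normrN ger0_norm ?cap_ge0 // /cap ge_min; apply/orP; right.
rewrite ler_pdivrMr // mulrC -ler_pdivrMr //.
by apply: le_trans (ltW (truncnS_gt _)) _; rewrite ler_nat ltnS.
Qed.

Section inf_convolution.
Variables (f : (R -> R) -> R) (M : R).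
Hypotheses (bf : bounded_cont_functional f) (fM : forall x, `|f x| <= M).

Let vals k z := [set f y + k%:R * snorm k%:R (fun t => y t - z t) | y in lucont].

(* The largest minorant of [f] that is [k]-Lipschitz for the sup norm on [0, k]. *)
Definition infconv (k : nat) z : R := if pselect (lucont z) then inf (vals k z) else 0.

Let M0 : 0 <= M. Proof. exact: le_trans (normr_ge0 _) (fM (fun=> 0)). Qed.

Let vals_lb k z v : vals k z v -> - M <= v.
Proof.
move=> [y _ <-]; have := fM y; rewrite ler_norml => /andP[h _].
by apply: le_trans h _; rewrite lerDl mulr_ge0 // snorm_ge0.
Qed.

Let vals_self k z : lucont z -> vals k z (f z).
Proof.
move=> uz; exists z => //; rewrite (_ : snorm _ _ = 0) ?mulr0 ?addr0 //.
apply/eqP; rewrite eq_le snorm_ge0 andbT; apply: snorm_le => // t _.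
by rewrite subrr normr0.
Qed.

Lemma infconv_le k z : lucont z -> infconv k z <= f z.
Proof.
move=> uz; rewrite /infconv; case: (pselect (lucont z)) => // p; apply: ge_inf; last exact: vals_self.
by exists (- M) => v; exact: vals_lb.
Qed.

Lemma infconv_norm k z : `|infconv k z| <= M.
Proof.
rewrite /infconv; case: pselect => uz; last by rewrite normr0.
rewrite ler_norml; apply/andP; split.
  by apply: lb_le_inf; [exists (f z); exact: vals_self|move=> v; exact: vals_lb].
have := fM z; rewrite ler_norml => /andP[_]; apply: le_trans.
by apply: ge_inf; [exists (- M) => v; exact: vals_lb|exact: vals_self].
Qed.

Lemma infconv_lip k x y : lucont x -> lucont y ->
  `|infconv k x - infconv k y| <= k%:R * snorm k%:R (fun t => x t - y t).
Proof.
have main u v : lucont u -> lucont v ->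
    infconv k u <= infconv k v + k%:R * snorm k%:R (fun t => u t - v t).
  move=> uu uv; rewrite /infconv; case: (pselect (lucont u)) => // p1; case: (pselect (lucont v)) => // p2.
  rewrite -lerBlDr; apply: lb_le_inf; first by exists (f v); exact: vals_self.
  move=> _ [q uq <-]; rewrite lerBlDr.
  apply: le_trans (_ : f q + k%:R * snorm k%:R (fun t => q t - u t) <= _).
    by apply: ge_inf; [exists (- M) => r; exact: vals_lb|exists q].
  rewrite -addrA lerD2l -mulrDr ler_wpM2l //.
  rewrite (snorm_distC _ u v).
  rewrite (_ : (fun t => q t - u t) = (fun t => (q t - v t) + (v t - u t))).
    by apply: snormD; exact: lucontB.
  by apply/funext => t; rewrite addrA subrK.
move=> ux uy; rewrite ler_distl; apply/andP; split.
  by rewrite lerBlDr snorm_distC; exact: main.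
exact: main.
Qed.

Lemma bcf_infconv k : bounded_cont_functional (infconv k).
Proof.
apply: (@lip_bcf _ k%:R k%:R M) => //; first exact: infconv_norm.
exact: infconv_lip.
Qed.

Lemma infconv_local k x y : lucont x -> lucont y -> (forall t, 0 <= t <= k%:R -> x t = y t) ->
  infconv k x = infconv k y.
Proof.
move=> ux uy xy; apply/eqP; rewrite -subr_eq0 -normr_le0.
apply: le_trans (infconv_lip k ux uy) _.
rewrite (_ : snorm _ _ = 0) ?mulr0 //.
apply/eqP; rewrite eq_le snorm_ge0 andbT; apply: snorm_le => // t tk.
by rewrite xy // subrr normr0.
Qed.

(** A near-minimizer [y k] pays [k] times its distance to [z] on [[0, k]], and the payment is
    bounded, so [y k] tends to [z] locally uniformly. Continuity of [f] then squeezes [infconv k z]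
    between [f (y k) - 1 / (k+1)] and [f z]. *)
Lemma infconv_cvg z : lucont z -> infconv k z @[k --> \oo] --> f z.
Proof.
move=> uz.
have near_opt k : exists2 y, lucont y &
    f y + k%:R * snorm k%:R (fun t => y t - z t) <= infconv k z + k.+1%:R^-1.
  have hi : has_inf (vals k z).
    by split; [exists (f z); exact: vals_self|exists (- M) => v; exact: vals_lb].
  have k0 : 0 < k.+1%:R^-1 :> R by rewrite invr_gt0.
  have [_ [y uy <-] hy] := inf_adherent k0 hi.
  exists y => //; rewrite /infconv; case: (pselect (lucont z)) => // p; exact: ltW.
have [y Hy] := choice (fun k => let: ex_intro2 y a b := near_opt k in ex_intro _ y (conj a b)).
(* [2 * M + 1] bounds [infconv k z + 1 / (k+1) - f (y k)]. *)
have ysmall k : (0 < k)%N -> snorm k%:R (fun t => y k t - z t) <= (2 * M + 1) / k%:R.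
  move=> k0; have [_ h] := Hy k; rewrite ler_pdivlMr ?ltr0n // [leLHS]mulrC.
  have := fM (y k); rewrite ler_norml => /andP[h1 _].
  have h2 : infconv k z <= M by have := infconv_norm k z; rewrite ler_norml => /andP[].
  have h3 : k.+1%:R^-1 <= 1 :> R by rewrite invf_le1 // ler1n.
  move: h h1 h2 h3; move: (infconv k z) (k.+1%:R^-1) (f (y k)) (k%:R * _) => a1 a2 a3 a4; lra.
have yz : f (y k) @[k --> \oo] --> f z.
  apply: (bcf_cvg bf) => // [k|]; first exact: (Hy k).1.
  move=> Tm e e0.
  exists (maxn 1 (maxn (Num.truncn Tm).+1 (Num.truncn ((2 * M + 1) / e)).+1)) => k.
  rewrite !geq_max => /and3P[k1 kT ke] t /andP[t0 tT].
  apply: le_trans (snorm_ub (x := fun t => y k t - z t) (Tm := k%:R) _ _) _.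
  - by apply: lucontB => //; exact: (Hy k).1.
  - rewrite t0; apply: le_trans tT _; apply: le_trans (ltW (truncnS_gt _)) _.
    by rewrite ler_nat.
  apply: le_trans (ysmall k k1) _; rewrite ler_pdivrMr ?ltr0n // [leRHS]mulrC -ler_pdivrMr //.
  by apply: le_trans (ltW (truncnS_gt _)) _; rewrite ler_nat.
apply/cvgrPdist_le => e e0.
have e2 : 0 < e / 2 by rewrite divr_gt0.
have /cvgrPdist_le/(_ _ e2)[N1 _ HN] := yz.
exists (maxn N1 (Num.truncn (e / 2)^-1)) => // k /=; rewrite geq_max => /andP[/HN kN ke].
rewrite ger0_norm ?subr_ge0 ?infconv_le //.
have [_ h] := Hy k.
have h0 : 0 <= k%:R * snorm k%:R (fun t => y k t - z t) by rewrite mulr_ge0 // snorm_ge0.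
have h3 : k.+1%:R^-1 <= e / 2.
  rewrite -[leRHS]invrK lef_pV2 ?posrE ?invr_gt0 //.
  by apply: le_trans (ltW (truncnS_gt _)) _; rewrite ler_nat ltnS.
move: kN; rewrite ler_norml => /andP[_]; move: h h0 h3.
move: (infconv k z) (k.+1%:R^-1) (f (y k)) (f z) (k%:R * _) => a1 a2 a3 a4 a5; lra.
Qed.

End inf_convolution.
End functionals.

(** * Pathwise coupling of two starting paths *)

Section coupling.
Context {R : realType}.
Variables (c Tm K : R) (x z : R -> R) (w : nat -> R -> R) (e : nat -> R).
Hypotheses (ux : lucont x) (uz : lucont z) (uw : forall k, lucont (w k)) (c0 : 0 <= c)
  (xz : forall t, 0 <= t <= Tm -> `|x t - z t| <= K).

Let S n := \sum_(i < n) e i.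
(* Below the level [Phi] the processes started from [x] and from [z] agree: the
   part of [layer] that depends on the starting path is bounded below by the
   layers with rate [2 * c] and half the waiting times. *)
Let Phi n t := layer (2 * c) z w (fun i => e i / 2) n t - S n / 2 - K - c * t.

Let SS n : S n.+1 = S n + e n. Proof. by rewrite /S big_ord_recr. Qed.

Lemma departure_le a y (v : R -> R) u s t : lucont y -> lucont v -> 0 <= s <= t ->
  departure a y v u t <= v t - v s + a * (t - s) + y s + u.
Proof.
move=> uy uv st; rewrite /departure.
have : run_inf (fun s => Num.min (y s - v s - a * s + u) 0) t <= y s - v s - a * s + u.
  by apply: le_trans (rinf_le (lucont_departure_in a u uy uv) st) _; rewrite ge_min; apply/orP; left.
lra.
Qed.

Lemma departure_le0 a y (v : R -> R) u t : lucont y -> lucont v -> 0 <= t ->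
  departure a y v u t <= v t + a * t.
Proof.
move=> uy uv t0; rewrite /departure gerDl.
have st : (0 : R) <= 0 <= t by rewrite lexx.
by apply: le_trans (rinf_le (lucont_departure_in a u uy uv) st) _; rewrite ge_min; apply/orP; right.
Qed.

Lemma le_departure a y (v : R -> R) u t r : 0 <= t -> r <= v t + a * t ->
  (forall s, 0 <= s <= t -> r <= v t - v s + a * (t - s) + y s + u) -> r <= departure a y v u t.
Proof.
move=> t0 h0 h; rewrite /departure -lerBlDl; apply: rinf_ge => // s /h hs.
by rewrite le_min; apply/andP; split; lra.
Qed.

(** The level satisfies [Phi n.+1 t <= w n t - w n s + c * (t - s) + Phi n s]: the surplus drift
    [c * (t - s)] of rate [2 * c] is exactly what the term [- c * t] in [Phi] takes back. Hence the
    comparison at [s], for [r] less the service increment, gives the comparison at [t]. *)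
Let step n y1 y2 : lucont y1 -> lucont y2 ->
  (forall t r, 0 <= t <= Tm -> r <= Phi n t -> r <= y1 t - S n -> r <= y2 t - S n) ->
  forall t r, 0 <= t <= Tm -> r <= Phi n.+1 t ->
  r <= departure c y1 (w n) (e n) t - S n.+1 -> r <= departure c y2 (w n) (e n) t - S n.+1.
Proof.
move=> u1 u2 H t r /andP[t0 tT] rPhi r1.
rewrite lerBrDr; apply: le_departure => //.
  by have := departure_le0 c (e n) u1 (uw n) t0; lra.
move=> s /[dup] st /andP[s0 st'].
have sT : 0 <= s <= Tm by rewrite s0 (le_trans st').
have h1 := departure_le c (e n) u1 (uw n) st.
have h2 := departure_le (2 * c) (e n / 2) (lucont_layer (2 * c) (fun i => e i / 2) n uz uw) (uw n) st.
have := H s (r - (w n t - w n s + c * (t - s))) sT.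
move: rPhi r1 h1 h2; rewrite /Phi SS /=.
set q := departure (2 * c) _ _ _ t; set q1 := departure c _ _ _ t; set l := layer _ _ _ _ n s.
move=> rPhi r1 h1 h2 H'.
have : r - (w n t - w n s + c * (t - s)) <= y2 s - S n by apply: H'; lra.
lra.
Qed.

(** Both processes, less [S n.+1], are at most [w n t + c * t - S n.+1]; the hypothesis puts this
    below [Phi n.+1 t], so each of the two values can serve as [r], which gives both
    inequalities. *)
Lemma coupling n : (forall t, 0 <= t <= Tm ->
    w n t - layer (2 * c) z w (fun i => e i / 2) n.+1 t + 2 * c * t + K <= S n.+1 / 2) ->
  forall t, 0 <= t <= Tm -> layer c x w e n.+1 t = layer c z w e n.+1 t.
Proof.
have main k : forall t r, 0 <= t <= Tm -> r <= Phi k t ->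
    (r <= layer c x w e k t - S k -> r <= layer c z w e k t - S k) /\
    (r <= layer c z w e k t - S k -> r <= layer c x w e k t - S k).
  elim: k => [|k IH] t r tT rPhi.
    (* Here [Phi 0 t = z t - K - c * t] lies below both starting paths, by [xz]. *)
    have ct : 0 <= c * t by rewrite mulr_ge0 //; case/andP: tT.
    have := xz tT; rewrite ler_norml => /andP[a1 a2].
    by move: rPhi; rewrite /Phi /S big_ord0 /=; split; lra.
  split; apply: step => //; try exact: lucont_layer.
    by move=> t' r' tT' h; have [] := IH t' r' tT' h.
  by move=> t' r' tT' h; have [] := IH t' r' tT' h.
move=> H t /[dup] tT /andP[t0 _].
have hx := departure_le0 c (e n) (lucont_layer c e n ux uw) (uw n) t0.
have hz := departure_le0 c (e n) (lucont_layer c e n uz uw) (uw n) t0.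
have Ht := H t tT.
have Px : layer c x w e n.+1 t - S n.+1 <= Phi n.+1 t.
  move: hx Ht; rewrite /Phi /=; set q := departure (2 * c) _ _ _ t; set q1 := departure c _ _ _ t; lra.
have Pz : layer c z w e n.+1 t - S n.+1 <= Phi n.+1 t.
  move: hz Ht; rewrite /Phi /=; set q := departure (2 * c) _ _ _ t; set q1 := departure c _ _ _ t; lra.
have [h1 _] := main n.+1 t _ tT Px; have [_ h2] := main n.+1 t _ tT Pz.
have := h1 (lexx _); have := h2 (lexx _).
set q := layer c x _ _ _ t; set q1 := layer c z _ _ _ t => g1 g2.
by apply/eqP; rewrite eq_le; apply/andP; split; lra.
Qed.

End coupling.

(** * Convergence *)

Section exponential_facts.
Context {R : realType}.
Variables (c : R) (c0 : 0 < c) (c20 : 0 < 2 * c).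
Local Notation mu := (@lebesgue_measure R).

(** Lets the halved variables drive a tandem of rate [2 * c], to which the invariance applies
    again. *)
Lemma exp_law_half (A : set R) : measurable A ->
  exp_law c0 [set x | A (x / 2)] = exp_law c20 A.
Proof.
move=> mA.
have mA2 : measurable [set x : R | A (x / 2)].
  have m2 : measurable_fun setT (fun x : R => x / 2) by exact: measurable_funM.
  by have := m2 measurableT A mA; rewrite setTI.
have mr : measurable_fun setT (exponential_pdf c) := measurable_exponential_pdf c.
pose f := (EFin \o exponential_pdf c) \_ [set x | A (x / 2)].
have f0 x : (0 <= f x)%E.
  by rewrite /f patchE; case: ifP => // _; rewrite lee_fin exponential_pdf_ge0 // ltW.
have mf : measurable_fun setT f.
  apply/(measurable_restrictT _ mA2); apply: measurable_funTS.
  exact/measurable_EFinP.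
transitivity (\int[mu]_x f x)%E; first by rewrite -integral_mkcond.
rewrite -(integral_affine 0 (ltr0Sn R 1) mf f0).
rewrite -ge0_integralZl //; first last.
- apply: (measurableT_comp mf); apply: measurable_funD => //; exact: measurable_funM.
transitivity (\int[mu]_x (((EFin \o exponential_pdf (2 * c)) \_ A) x))%E; last by rewrite -integral_mkcond.
apply: eq_integral => x _; rewrite /f !patchE addr0.
have -> : (2 * x \in [set x | A (x / 2)]) = (x \in A).
  have xE : 2 * x / 2 = x by field.
  by apply/idP/idP; rewrite !inE /= xE.
case: ifP => _; last by rewrite mule0.
rewrite -EFinM /=; congr EFin.
have [x0|x0] := leP 0 x; last by rewrite !lt0_exponential_pdf ?mulr0 // pmulr_rlt0.
rewrite !exponential_pdfE ?mulr_ge0 // mulrA; congr (_ * expR _); ring.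
Qed.

Lemma exp_law_itv (C : R) : 0 < C -> exp_law c0 `[0, C]%classic = (1 - expR (- c * C))%:E.
Proof. by move=> C0; rewrite EFinB; exact: exponential_prob_itv0c. Qed.

End exponential_facts.

Section bmfun_facts.
Context {R : realType} {d} {T : measurableType d} (P : probability T R).
Implicit Types F G : T -> R.

Lemma bmfunD F G M M' : bmfun F M -> bmfun G M' -> bmfun (fun t => F t + G t) (M + M').
Proof.
move=> [mF hF] [mG hG]; split=> [|t]; first exact: measurable_funD.
by apply: le_trans (ler_normD _ _) _; exact: lerD.
Qed.

Lemma bmfunZ F M r : bmfun F M -> bmfun (fun t => r * F t) (`|r| * M).
Proof.
move=> [mF hF]; split=> [|t]; first exact: measurable_funM.
by rewrite normrM ler_wpM2l.
Qed.

Lemma bmfun_indic (D : set T) : measurable D -> bmfun (\1_D : T -> R) 1.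
Proof.
move=> mD; split=> [|t]; first exact: measurable_indic.
by rewrite indicE; case: (_ \in _); rewrite ?normr1 ?normr0.
Qed.

Lemma expect_indic (D : set T) : measurable D -> (\int[P]_t (\1_D t : R))%:E = P D.
Proof. by move=> mD; rewrite -(expect_fin P (bmfun_indic mD)) integral_indic // setIT. Qed.

End bmfun_facts.

Section convergence.
Context {R : realType} {d} {T : measurableType d} (P : probability T R)
  {d'} {T' : measurableType d'} (P' : probability T' R).
Variables (c : R) (A0 : T -> R -> R) (W : nat -> T -> R -> R) (E : nat -> T -> R)
  (B : T' -> R -> R).
Hypotheses (c0 : 0 < c) (gA : good_proc A0) (gW : forall i, good_proc (W i))
  (mE : forall i, measurable_fun setT (E i)) (E0 : forall i t, 0 <= E i t)
  (gB : good_proc B).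

Let Wp i := W i.+1.
Let Ep i := E i.+1.
Let Eh i t := Ep i t / 2.

Hypotheses
  (HI : forall n N, tandem_indep P (hN N) c0 n (MN N) (fun j t => incr (hN N) (W 0%N t) j)
     (fun i j t => incr (hN N) (Wp i t) j) Ep)
  (HW : forall i N, grid_law P (hN N) (MN N) (fun j t => incr (hN N) (W i t) j))
  (HB : forall N, grid_law P' (hN N) (MN N) (fun j t => incr (hN N) (B t) j)).

Let c20 : 0 < 2 * c. Proof. by rewrite mulr_gt0. Qed.
Let gWp i : good_proc (Wp i). Proof. exact: gW. Qed.
Let mEp i : measurable_fun setT (Ep i). Proof. exact: mE. Qed.
Let Ep0 i t : 0 <= Ep i t. Proof. exact: E0. Qed.
Let mEh i : measurable_fun setT (Eh i). Proof. by apply: measurable_funM. Qed.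
Let Eh0 i t : 0 <= Eh i t. Proof. by rewrite divr_ge0. Qed.

Let HI2 n N : tandem_indep P (hN N) c20 n (MN N) (fun j t => incr (hN N) (W 0%N t) j)
     (fun i j t => incr (hN N) (Wp i t) j) Eh.
Proof.
move=> Ab Aw Ae mAb mAw mAe.
pose Ae2 i := [set x : R | Ae i (x / 2)].
have mAe2 i : measurable (Ae2 i).
  have m2 : measurable_fun setT (fun x : R => x / 2) by exact: measurable_funM.
  by have := m2 measurableT (Ae i) (mAe i); rewrite setTI.
have := HI n N mAb mAw mAe2 => H.
transitivity (gprod (hN N) (MN N) Ab * eprod (hN N) c0 n (MN N) Aw Ae2)%E.
  by rewrite -H; congr (P _); apply/seteqP; split.
by congr (_ * _)%E; apply: eq_bigr => i _; rewrite (exp_law_half c0 c20 (mAe i)).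
Qed.

Let mincr i N j : measurable_fun setT (fun t => incr (hN N) (W i t) j).
Proof. by apply: measurable_incr; [exact: ltW (hN_gt0 N)|exact: (gW i).1]. Qed.

Let grid_layer (a : R) (a0 : 0 < a) e n N : (forall i, measurable_fun setT (e i)) ->
  tandem_indep P (hN N) a0 n (MN N) (fun j t => incr (hN N) (W 0%N t) j)
     (fun i j t => incr (hN N) (Wp i t) j) e ->
  grid_law P (hN N) (MN N) (dincr (W 0%N) Wp e a n N).
Proof.
move=> me H D mD.
exact: (@tandem_law _ _ _ P a (hN N) a0 (hN_gt0 N) n (MN N) (fun j t => incr (hN N) (W 0%N t) j)
     (fun i j t => incr (hN N) (Wp i t) j) e (mincr 0%N N) (fun i j => mincr i.+1 N j) me H D mD).
Qed.

Let mzero (i : nat) : measurable_fun setT (fun _ : T' => 0 : R).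
Proof. exact: measurable_cst. Qed.

(** [B] is viewed as a tandem of length [0], with filler services and waiting times. *)
Let burke f n : bounded_cont_functional f ->
  \int[P]_t f (layerT (W 0%N) Wp Ep c n t) = \int[P']_t f (B t).
Proof.
move=> bf; apply: (@expect_layerT_eq _ _ _ _ _ P P' (W 0%N) Wp Ep B (fun=> B) (fun _ _ => 0) c c n 0%N) => //.
by move=> N; exact: grid_layer.
Qed.

Let burke2 f n : bounded_cont_functional f ->
  \int[P]_t f (layerT (W 0%N) Wp Eh (2 * c) n t) = \int[P']_t f (B t).
Proof.
move=> bf; apply: (@expect_layerT_eq _ _ _ _ _ P P' (W 0%N) Wp Eh B (fun=> B) (fun _ _ => 0) (2 * c) c n 0%N) => //.
by move=> N; exact: grid_layer.
Qed.

Let bmlaw f i : bounded_cont_functional f ->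
  \int[P]_t f (W i t) = \int[P']_t f (B t).
Proof.
move=> bf; apply: (@expect_layerT_eq _ _ _ _ _ P P' (W i) Wp Ep B (fun=> B) (fun _ _ => 0) c c 0%N 0%N) => //.
by move=> N; exact: HW.
Qed.

(** Since the variables are nonnegative, their sum exceeds [C] outside [J C n]. The probability of
    [J C n] is a power of a number below [1], so [S_n] diverges in probability by a direct
    computation. *)
Let J (C : R) n : set T := [set t | forall i, (i < n)%N -> `[0, C]%classic (Ep i t)].

Let measurable_J C n : measurable (J C n).
Proof.
have := @measurable_evt _ _ _ n 0 (fun _ _ _ => 0) Ep (fun _ _ => setT) (fun=> `[0, C]%classic).
move=> /(_ (fun _ _ => measurable_cst _) mEp (fun _ _ => measurableT) (fun=> measurable_itv _)).
by congr (measurable _); apply/seteqP; split=> t /= H i /H => [[]|] //.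
Qed.

Let P_J C n : 0 < C -> P (J C n) = ((1 - expR (- c * C)) ^+ n)%:E.
Proof.
move=> C0.
(* Any mesh would do: the Gaussian factors are evaluated on the whole line and equal [1]. *)
have := HI n 0 (Ab := fun=> setT) (Aw := fun _ _ => setT) (Ae := fun=> `[0, C]%classic).
move=> /(_ (fun=> measurableT) (fun _ _ => measurableT) (fun=> measurable_itv _)).
rewrite cylT setTI gprodT mul1e => HJ.
transitivity (eprod (hN 0) c0 n (MN 0) (fun _ _ => setT) (fun=> `[0, C]%classic)).
  by rewrite -HJ; congr (P _); apply/seteqP; split=> t /= H i /H => [|[]].
rewrite /eprod; under eq_bigr do rewrite gprodT mule1 exp_law_itv //.
by elim: n {HJ} => [|n IH]; [rewrite big_ord0 expr0|rewrite big_ord_recl IH exprS EFinM].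
Qed.

(** With [F] the Lipschitz minorant, [f >= F]; the values of [F] on the two coupled systems differ
    by at most [2 * M * bad]; and the Brownian system gives [F] the same mean as [B]. *)
Let lower f eps : bounded_cont_functional f -> 0 < eps -> exists n0, forall n, (n0 <= n)%N ->
  \int[P']_t f (B t) - eps <= \int[P]_t f (layerT A0 W E c n t).
Proof.
move=> bf eps0; have [[M fM] _] := bf.
have M0 : 0 <= M by exact: le_trans (normr_ge0 _) (fM (fun=> 0)).
have bmB g M' : bounded_cont_functional g -> (forall x, `|g x| <= M') -> bmfun (fun t => g (B t)) M'.
  by move=> bg gM; exact: (@bmfun_layerT _ _ _ B (fun=> B) (fun _ _ => 0) gB (fun=> gB) mzero (fun _ _ => lexx 0) c 0%N).
have bmW i g M' : bounded_cont_functional g -> (forall x, `|g x| <= M') -> bmfun (fun t => g (W i t)) M'.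
  by move=> bg gM; exact: (@bmfun_layerT _ _ _ (W i) Wp Ep (gW i) gWp mEp Ep0 c 0%N).
have bmX n g M' : bounded_cont_functional g -> (forall x, `|g x| <= M') ->
    bmfun (fun t => g (layerT A0 W E c n t)) M' by exact: bmfun_layerT.
have bmfunZ' n g M' : bounded_cont_functional g -> (forall x, `|g x| <= M') ->
    bmfun (fun t => g (layerT (W 0%N) Wp Ep c n t)) M' by exact: bmfun_layerT.
have bmZt n g M' : bounded_cont_functional g -> (forall x, `|g x| <= M') ->
    bmfun (fun t => g (layerT (W 0%N) Wp Eh (2 * c) n t)) M' by exact: bmfun_layerT.
have e2 : 0 < eps / 2 by rewrite divr_gt0.
have Ck := expect_cvg (P := P') (fun k => bmB _ M (bcf_infconv fM k) (infconv_norm fM k))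
   (fun t => infconv_cvg bf fM (gB.2 t).1).
(* Half of [eps] pays for replacing [f] by [F] under [B]. The index [k], and with it the horizon of
   the coupling, is fixed before [n]. *)
have /cvgrPdist_le/(_ _ e2)[k _ /(_ k (leqnn k)) {Ck}] := Ck.
rewrite ler_norml => /andP[_ Hk].
pose F := infconv f k; pose Tm : R := k%:R.
have Tm0 : 0 <= Tm by [].
(* [bad] is a sum of five terms of mean at most [del], weighted by [2 * M], and
   [10 * M * del <= eps / 2]; [M + 1] keeps the denominator positive. *)
pose del := eps / (20 * (M + 1)).
have M1 : 0 < M + 1 by rewrite ltr_wpDl.
have del0 : 0 < del by rewrite divr_gt0 // mulr_gt0.
have Cc m : bounded_cont_functional (cap Tm m.+1%:R) by exact: bcf_cap.
have cn m x : `|cap Tm m.+1%:R x| <= 1 by exact: cap_norm.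
have CX := expect_cvg (P := P) (fun m => bmX 1%N _ _ (Cc m) (cn m)) (fun t => cap_cvg0 Tm _).
have CB := expect_cvg (P := P') (fun m => bmB _ _ (Cc m) (cn m)) (fun t => cap_cvg0 Tm _).
rewrite Rintegral_cst // mul0r in CX; rewrite Rintegral_cst // mul0r in CB.
have /cvgrPdist_le/(_ _ del0)[m1 _ H1] := CX.
have /cvgrPdist_le/(_ _ del0)[m2 _ H2] := CB.
pose m := maxn m1 m2; pose rho : R := m.+1%:R.
have rho0 : 0 < rho by rewrite ltr0n.
have HX : \int[P]_t cap Tm rho (layerT A0 W E c 1 t) <= del.
  have := H1 m (leq_maxl _ _); rewrite sub0r normrN; exact: le_trans (ler_norm _).
have HBm : \int[P']_t cap Tm rho (B t) <= del.
  have := H2 m (leq_maxr _ _); rewrite sub0r normrN; exact: le_trans (ler_norm _).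
have {H1 H2 CX CB} Ccap := Cc m; have ccap := cn m; rewrite -/rho in Ccap ccap.
(* [C / 2] is what [coupling] asks for: [rho] for the last service, [rho] for the layer of rate
   [2 * c], [2 * rho] for the distance of the starting paths and [2 * c * Tm] for the drift. *)
pose C := 2 * (4 * rho + 2 * c * Tm).
have C0 : 0 < C by rewrite mulr_gt0 // ltr_wpDr ?mulr_gt0 // !mulr_ge0 // ltW.
have r0 : `|1 - expR (- c * C)| < 1.
  have h1 : 0 < expR (- c * C) by exact: expR_gt0.
  have h2 : expR (- c * C) <= 1.
    by rewrite -expR0 ler_expR mulNr oppr_le0 mulr_ge0 // ltW.
  by rewrite ger0_norm ?subr_ge0 // gtrBl.
have /cvgrPdist_le/(_ _ del0)[n1 _ Hn1] := cvg_expr r0.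
(* One queue goes into the starting path, and [coupling] speaks of [n.+1] further ones. *)
exists n1.+2 => -[//|[//|n]] nn.
have HJ : \int[P]_t (\1_(J C n.+1) t : R) <= del.
  have -> : \int[P]_t (\1_(J C n.+1) t : R) = (1 - expR (- c * C)) ^+ n.+1.
    by apply: EFin_inj; rewrite expect_indic // P_J.
  have := Hn1 n.+1; rewrite sub0r normrN => /(_ _) H; apply: le_trans (ler_norm _) (H _).
  by apply: leq_trans (leqnSn _); rewrite -2!ltnS.
pose b1 t := cap Tm rho (layerT A0 W E c 1 t).
pose b2 t := cap Tm rho (W 0%N t).
pose b3 t := cap Tm rho (Wp n t).
pose b4 t := cap Tm rho (layerT (W 0%N) Wp Eh (2 * c) n.+1 t).
pose b5 t : R := \1_(J C n.+1) t.
(* All terms are nonnegative, so [bad t < 1] forces the four sup norms below [rho] and [t] outside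
   [J C n.+1]. *)
pose bad t := b1 t + (b2 t + (b3 t + (b4 t + b5 t))).
have bm1 : bmfun b1 1 by exact: bmX.
have bm2 : bmfun b2 1 by exact: bmW.
have bm3 : bmfun b3 1 by exact: bmW.
have bm4 : bmfun b4 1 by exact: bmZt.
have bm5 : bmfun b5 1 by exact: bmfun_indic.
have bm45 := bmfunD bm4 bm5; have bm345 := bmfunD bm3 bm45.
have bm2345 := bmfunD bm2 bm345; have bmbad := bmfunD bm1 bm2345.
have Ebad : \int[P]_t bad t <= 5 * del.
  rewrite /bad (expectD P bm1 bm2345) (expectD P bm2 bm345) (expectD P bm3 bm45) (expectD P bm4 bm5).
  (* These means reduce to one mean under [B], so the bound is uniform in [n]. *)
  have -> : \int[P]_t b2 t = \int[P']_t cap Tm rho (B t) by exact: bmlaw.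
  have -> : \int[P]_t b3 t = \int[P']_t cap Tm rho (B t) by exact: bmlaw.
  have -> : \int[P]_t b4 t = \int[P']_t cap Tm rho (B t) by exact: burke2.
  by move: HX HBm HJ; rewrite -/b1 -/b5; lra.
have bmFZ : bmfun (fun t => F (layerT (W 0%N) Wp Ep c n.+1 t)) M.
  by apply: bmfunZ'; [exact: bcf_infconv|exact: infconv_norm].
have EFZ : \int[P]_t F (layerT (W 0%N) Wp Ep c n.+1 t) = \int[P']_t F (B t).
  by apply: burke; exact: bcf_infconv.
have b1_ge0 t : 0 <= b1 t by apply: cap_ge0; exact: ltW.
have b2_ge0 t : 0 <= b2 t by apply: cap_ge0; exact: ltW.
have b3_ge0 t : 0 <= b3 t by apply: cap_ge0; exact: ltW.
have b4_ge0 t : 0 <= b4 t by apply: cap_ge0; exact: ltW.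
have b5_ge0 t : 0 <= b5 t by rewrite /b5 indicE.
have key t : F (layerT (W 0%N) Wp Ep c n.+1 t) + (- (2 * M)) * bad t <= f (layerT A0 W E c n.+2 t).
  have uX : lucont (layerT A0 W E c n.+2 t) by exact: lucont_layerT.
  apply: le_trans (infconv_le fM k uX).
  (* Where [bad t >= 1] the correction already covers the oscillation [2 * M] of [F]; elsewhere the
     two systems agree on [[0, k]]. *)
  have [bad1|bad1] := ltP (bad t) 1; last first.
    have h1 := infconv_norm fM k (layerT (W 0%N) Wp Ep c n.+1 t).
    have h2 := infconv_norm fM k (layerT A0 W E c n.+2 t).
    move: h1 h2; rewrite !ler_norml => /andP[_ h1] /andP[h2 _].
    have : 2 * M <= 2 * M * bad t by rewrite ler_peMr // mulr_ge0.
    rewrite mulNr; move: (2 * M * bad t) h1 h2 => v; rewrite -/F.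
    by move: (F _) (F _) => v1 v2; lra.
  rewrite mulNr; apply: le_trans (_ : F (layerT (W 0%N) Wp Ep c n.+1 t) <= _).
    by rewrite gerBl !mulr_ge0 // !addr_ge0.
  rewrite le_eqVlt; apply/orP; left; apply/eqP.
  have [c1 c2 c3 c4 c5] : [/\ b1 t < 1, b2 t < 1, b3 t < 1, b4 t < 1 & b5 t < 1].
    have := b1_ge0 t; have := b2_ge0 t; have := b3_ge0 t; have := b4_ge0 t; have := b5_ge0 t.
    by move: bad1; rewrite /bad; move: (b1 t) (b2 t) (b3 t) (b4 t) (b5 t); split; lra.
  have s1 := cap_lt1 rho0 c1; have s2 := cap_lt1 rho0 c2.
  have s3 := cap_lt1 rho0 c3; have s4 := cap_lt1 rho0 c4.
  have u1 : lucont (layerT A0 W E c 1 t) by exact: lucont_layerT.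
  have uW i : lucont (W i t) by exact: ((gW i).2 t).1.
  have Slarge : C < \sum_(i < n.+1) Ep i t.
    have /existsNP[i /not_implyP[ii Hi]] : ~ J C n.+1 t.
      by move=> Jt; move: c5; rewrite /b5 indicE mem_set // ltxx.
    have Ci : C < Ep i t.
      by rewrite ltNge; apply/negP => h; apply: Hi; rewrite /= in_itv /= Ep0 h.
    apply: lt_le_trans Ci _; rewrite (bigD1 (Ordinal ii)) //= lerDl.
    by apply: sumr_ge0 => j _.
  apply: infconv_local => //; first exact: lucont_layerT.
  move=> s sT; rewrite /layerT (layer_front c (A0 t) (W ^~ t) (E ^~ t) n.+1); apply/esym.
  have xz s' : 0 <= s' <= Tm -> `|departure c (A0 t) (W 0%N t) (E 0%N t) s' - W 0%N t s'| <= 2 * rho.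
    move=> sT'; apply: le_trans (ler_normB _ _) _.
    have h1 := le_lt_trans (snorm_ub u1 sT') s1.
    have h2 := le_lt_trans (snorm_ub (uW 0%N) sT') s2.
    by rewrite /layerT /= in h1; lra.
  have gap s' : 0 <= s' <= Tm -> Wp n t s' - layer (2 * c) (W 0%N t) (Wp ^~ t) (fun i => Ep i t / 2) n.+1 s' +
      2 * c * s' + 2 * rho <= (\sum_(i < n.+1) Ep i t) / 2.
    move=> /[dup] sT' /andP[s0' s1'].
    have h3 := le_lt_trans (snorm_ub (uW n.+1) sT') s3.
    have uZt : lucont (layerT (W 0%N) Wp Eh (2 * c) n.+1 t) by exact: lucont_layerT.
    have h4 := le_lt_trans (snorm_ub uZt sT') s4.
    have h5 : 2 * c * s' <= 2 * c * Tm by rewrite ler_pM2l // mulr_gt0.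
    rewrite -[layer _ _ _ _ _ s']/(layerT (W 0%N) Wp Eh (2 * c) n.+1 t s') -[Wp n t s']/(W n.+1 t s').
    move: h3 h4 h5 Slarge; rewrite /C.
    move: (layerT _ _ _ _ _ t s') (\sum_(i < n.+1) _) (2 * c * Tm) (2 * c * s') (W n.+1 t s') => a1 a2 a3 a4 a5.
    by rewrite !ltr_norml; lra.
  have := @coupling _ c Tm (2 * rho) (departure c (A0 t) (W 0%N t) (E 0%N t)) (W 0%N t) (Wp ^~ t) (Ep ^~ t)
    u1 (uW 0%N) (fun i => uW i.+1) (ltW c0) xz n gap s sT.
  exact.
have bmR := bmfunD bmFZ (bmfunZ (- (2 * M)) bmbad).
have := expect_le P bmR (bmX n.+2 f M bf fM) key.
rewrite (expectD P bmFZ (bmfunZ (- (2 * M)) bmbad)) (expectZ P _ bmbad) EFZ.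
apply: le_trans.
have h6 : 2 * M * \int[P]_t bad t <= eps / 2.
  apply: le_trans (_ : 2 * M * (5 * del) <= _).
    by rewrite ler_wpM2l // mulr_ge0.
  rewrite /del.
  have -> : 2 * M * (5 * (eps / (20 * (M + 1)))) = (eps / 2) * (M / (M + 1)).
    by field; rewrite gt_eqF.
  rewrite ger_pMr // ler_pdivrMr // mul1r lerDl.
  exact: ler01.
move: Hk h6; rewrite -/F mulNr.
move: (\int[P']_t F (B t)) (\int[P']_t f (B t)) (2 * M * _) => v1 v2 v3; lra.
Qed.

Lemma departures_cvg f : bounded_cont_functional f ->
  \int[P]_t f (layerT A0 W E c n t) @[n --> \oo] --> \int[P']_t f (B t).
Proof.
move=> bf; have [[M fM] cf] := bf.
have bfN : bounded_cont_functional (fun x => - f x).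
  split; first by exists M => x; rewrite normrN.
  by move=> gs g h1 h2 h3; apply: cvgN; exact: cf.
have bB : bmfun (fun t => f (B t)) M.
  exact: (@bmfun_layerT _ _ _ B (fun=> B) (fun _ _ => 0) gB (fun=> gB) mzero (fun _ _ => lexx 0) c 0%N).
have bX n : bmfun (fun t => f (layerT A0 W E c n t)) M by exact: bmfun_layerT.
apply/cvgrPdist_le => e e0.
have [n1 H1] := lower bf e0; have [n2 H2] := lower bfN e0.
exists (maxn n1 n2) => // n /=; rewrite geq_max => /andP[/H1 {}H1 /H2].
have EN d0 (T0 : measurableType d0) (P0 : probability T0 R) G : bmfun G M ->
    \int[P0]_t (- G t) = - \int[P0]_t G t.
  by move=> bG; under eq_Rintegral do rewrite -mulN1r; rewrite (expectZ P0 _ bG) mulN1r.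
rewrite (EN _ _ P' _ bB) (EN _ _ P _ (bX n)) => {}H2.
by rewrite ler_norml; lra.
Qed.

End convergence.

(** * From the probabilistic hypotheses to grid laws *)

Section gaussian_grid.
Context {R : realType} {d} {T : measurableType d} (P : probability T R).

Lemma std_BM_grid (X : T -> R -> R) h M (A : nat -> set R) : std_BM P X -> 0 < h ->
  (forall j, measurable (A j)) ->
  P (cyl M (fun j t => incr h (X t) j) A) = gprod h M A.
Proof.
move=> [_ _ HX] h0 mA.
pose ts := mkseq (fun j => j.+1%:R * h) M.
pose B := mkseq A M.
have sts : size ts = M by rewrite size_mkseq.
(* Prepending [0] shifts the index: entry [i] is the left end of cell [i]. *)
have nth0 i : (i <= M)%N -> nth 0 (0 :: ts) i = i%:R * h.
  by case: i => [|i] iM /=; [rewrite mul0r|rewrite nth_mkseq].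
have pts : path <%R 0 ts.
  apply/(pathP 0) => i; rewrite sts => iM.
  by rewrite nth0 1?ltnW // nth_mkseq // ltr_pM2r // ltr_nat.
have mB b : b \in B -> measurable b by move=> /mapP[j _ ->].
have := HX ts B; rewrite sts size_mkseq => /(_ erefl pts mB) H.
transitivity (P (\bigcap_(i in [set i | (i < M)%N])
   [set w | X w (nth 0 ts i) - X w (nth 0 (0 :: ts) i) \in nth set0 B i])).
  by congr (P _); apply/seteqP; split=> t /= Ht i /= iM; have := Ht i iM;
    rewrite /= nth_mkseq // nth0 1?ltnW // nth_mkseq // inE.
rewrite H /gprod; apply: eq_bigr => i _.
have iM := ltn_ord i; rewrite (nth0 _ (ltnW iM)) (nth_mkseq _ _ iM) (nth_mkseq _ _ iM).
have -> : i.+1%:R * h - i%:R * h = h by rewrite mulrSr; ring.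
exact.
Qed.

(** Membership in the generated sigma-algebra is measurability over [T] re-equipped with that
    sigma-algebra, where [X] is a process by construction. *)
Lemma sigma_proc_cyl (X : T -> R -> R) h M (A : nat -> set R) : 0 <= h ->
  (forall j, measurable (A j)) ->
  sigma_proc X (cyl M (fun j t => incr h (X t) j) A).
Proof.
move=> h0 mA; set G := [set (fun w => X w t) @^-1` B | t in `[0, +oo[ & B in @measurable _ R].
have pX : @is_process R _ (g_sigma_algebraType G) X.
  move=> t t0 _ B mB; rewrite setTI; apply: sub_gen_smallest.
  by exists t; [rewrite /= in_itv /= t0|exists B].
have : measurable (cyl (T := g_sigma_algebraType G) M (fun j t => incr h (X t) j) A).
  by apply: measurable_cyl => // j; exact: measurable_incr.
by [].
Qed.

End gaussian_grid.

Section independent_data.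
Context {R : realType} {d} {T : measurableType d} (P : probability T R).
Variables (c : R) (A0 : T -> R -> R) (W : nat -> T -> R -> R) (E : nat -> T -> R).
Hypotheses (c0 : 0 < c) (HW : forall n, std_BM P (W n)) (HE : forall n, exp_rv P c (E n)).
Hypothesis HI : mutually_independent P
    (fun i : option (nat + nat) => match i with
      | None => sigma_proc A0
      | Some (inl n) => sigma_proc (W n)
      | Some (inr n) => sigma_rv (E n) end).

(** [J] lists [W 0], then the services, then the waiting times of the later queues; the product over
    [J] is regrouped queue by queue to match [eprod]. *)
Lemma data_indep h n M : 0 < h ->
  tandem_indep P h c0 n M (fun j t => incr h (W 0%N t) j)
     (fun i j t => incr h (W i.+1 t) j) (fun i => E i.+1).
Proof.
move=> h0 Ab Aw Ae mAb mAw mAe.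
have h0' := ltW h0.
pose ev (i : option (nat + nat)) : set T := match i with
  | None => setT
  | Some (inl 0%N) => cyl M (fun j t => incr h (W 0%N t) j) Ab
  | Some (inl i.+1) => cyl M (fun j t => incr h (W i.+1 t) j) (Aw i)
  | Some (inr 0%N) => setT
  | Some (inr i.+1) => E i.+1 @^-1` Ae i end.
pose fW i : option (nat + nat) := Some (inl i.+1).
pose fE i : option (nat + nat) := Some (inr i.+1).
pose J := Some (inl 0%N) :: [seq fW i | i <- iota 0 n] ++ [seq fE i | i <- iota 0 n].
have injW : injective fW by move=> i j [].
have injE : injective fE by move=> i j [].
have uJ : uniq J.
  rewrite /J /= cat_uniq !map_inj_uniq // !iota_uniq andbT /= mem_cat negb_or.
  apply/andP; split; last by apply/hasPn => _ /mapP[i _ ->]; apply/negP => /mapP[].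
  by apply/andP; split; apply/negP => /mapP[].
have mJ i : i \in J -> match i with
      | None => sigma_proc A0
      | Some (inl n) => sigma_proc (W n)
      | Some (inr n) => sigma_rv (E n) end (ev i).
  rewrite inE mem_cat => /orP[/eqP ->|/orP[] /mapP[k _ ->]] /=.
  - exact: sigma_proc_cyl.
  - exact: sigma_proc_cyl.
  - by apply: sub_gen_smallest; exists (Ae k).
have := HI uJ mJ; rewrite /J big_cons big_cat !big_map /= => H.
transitivity (P (\bigcap_(j in [set j | j \in J]) ev j)).
  congr (P _); apply/seteqP; split=> t /=.
    move=> [H0 H1] j; rewrite /= inE mem_cat => /orP[/eqP -> //|/orP[] /mapP[k + ->]];
      by rewrite mem_iota /= add0n => /H1[].
  move=> Ht; split; first by apply: (Ht (Some (inl 0%N))); rewrite /= inE eqxx.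
  move=> i im; split.
    by apply: (Ht (fE i)); rewrite /= inE mem_cat [X in _ || X]orbC map_f ?orbT // mem_iota.
  by apply: (Ht (fW i)); rewrite /= inE mem_cat map_f ?orbT // mem_iota.
rewrite H; congr (_ * _)%E; first exact: std_BM_grid.
rewrite -big_split /eprod -(big_mkord xpredT (fun i => exp_law c0 (Ae i) * gprod h M (Aw i))%E).
rewrite /index_iota subn0; apply: eq_bigr => i _; rewrite muleC; congr (_ * _)%E.
  exact: std_BM_grid.
exact: ((HE i.+1).2 (Ae i) (mAe i)).
Qed.

End independent_data.

Section modification.
Context {R : realType} {d} {T : measurableType d} (P : probability T R).

Lemma measure_eq_off_null (N A B : set T) : measurable N -> P N = 0%E ->
  measurable A -> measurable B -> (forall t, ~ N t -> A t <-> B t) -> P A = P B.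
Proof.
move=> mN PN mA mB AB.
have off D : measurable D -> P D = P (D `\` N).
  move=> mD; have Z : P (D `&` N) = 0%E.
    apply/eqP; rewrite eq_le measure_ge0 andbT -PN.
    by apply: le_measure; rewrite ?inE //; exact: measurableI.
  transitivity (P (D `\` N) + P (D `&` N))%E; first exact: measureDI.
  by rewrite Z adde0.
rewrite (off A mA) (off B mB); congr (P _).
by apply/seteqP; split=> t [h1 h2]; split=> //; apply/(AB t h2).
Qed.

(** Replacing the path by [0] on a null set makes almost sure path properties hold everywhere, and
    the indicator factor keeps each coordinate measurable. *)
Definition kill (N : set T) (X : T -> R -> R) t s : R := \1_(~` N) t * X t s.

Lemma kill_off N X t : ~ N t -> kill N X t = X t.
Proof. by move=> Nt; apply/funext => s; rewrite /kill indicE mem_set // mul1r. Qed.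

Lemma kill_in (N : set T) X t : N t -> kill N X t = fun=> 0.
Proof.
by move=> Nt; apply/funext => s; rewrite /kill indicE memNset ?mul0r // => /(_ Nt).
Qed.

Lemma measurable_kill N X : measurable N -> is_process X -> is_process (kill N X).
Proof.
move=> mN pX t t0; apply: measurable_funM; last exact: pX.
by apply: measurable_indic; exact: measurableC.
Qed.

Lemma kill_good N X : measurable N -> is_process X ->
  (forall t, ~ N t -> cont_path (X t) /\ X t 0 = 0) -> good_proc (kill N X).
Proof.
move=> mN pX H; split; first exact: measurable_kill.
move=> t; have [Nt|Nt] := pselect (N t).
  by rewrite kill_in //; split=> //; exact: lucont_cst.
by rewrite kill_off //; have [/cont_path_lucont uX X0] := H t Nt.
Qed.

Lemma kill_grid N X h M : measurable N -> P N = 0%E -> 0 < h -> is_process X ->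
  grid_law P h M (fun j t => incr h (X t) j) ->
  grid_law P h M (fun j t => incr h (kill N X t) j).
Proof.
move=> mN PN h0 pX L D mD; rewrite -L //.
have h0' := ltW h0.
apply: (measure_eq_off_null mN PN).
- by apply: measurable_cyl => // j; apply: measurable_incr => //; exact: measurable_kill.
- by apply: measurable_cyl => // j; exact: measurable_incr.
by move=> t Nt; split=> H j /H; rewrite kill_off.
Qed.

End modification.

Theorem theorem2 (R : realType) (d : measure_display) (T : measurableType d)
  (P : probability T R) (c : R) (A0 : T -> R -> R) (W : nat -> T -> R -> R)
  (E : nat -> T -> R) :
  0 < c ->
  is_process A0 ->
  {ae P, forall w, cont_path (A0 w)} ->
  (forall w, A0 w 0 = 0) ->
  (forall n, std_BM P (W n)) ->
  (forall n, exp_rv P c (E n)) ->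
  mutually_independent P
    (fun i : option (nat + nat) => match i with
      | None => sigma_proc A0
      | Some (inl n) => sigma_proc (W n)
      | Some (inr n) => sigma_rv (E n) end) ->
  forall (d' : measure_display) (T' : measurableType d') (P' : probability T' R)
         (B : T' -> R -> R),
  std_BM P' B ->
  forall f : (R -> R) -> R, bounded_cont_functional f ->
  (fun n => Epath P f (fun w t => Aproc c A0 W E n w t + Esum E n w)) @ \oo
    --> Epath P' f B.
Proof.
move=> c0 pA cA A00 HW HE HI d' T' P' B HB f bf.
have aeE n : {ae P, forall w, 0 <= E n w}.
  exists (E n @^-1` `]-oo, 0[%classic); split.
  - by rewrite -[X in measurable X]setTI; exact: (HE n).1.
  - rewrite (HE n).2 // /exponential_prob; apply: integral0_eq => x /=.
    by rewrite in_itv /= => x0; rewrite lt0_exponential_pdf.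
  - by move=> w /= /negP; rewrite -ltNge in_itv.
have aeW : {ae P, forall w, forall n, cont_path (W n w) /\ W n w 0 = 0}.
  by apply: ae_foralln => n; have [] := HW n.
(* A single null set serves the countably many processes and variables. *)
have [N [mN PN HN]] : {ae P, forall w, cont_path (A0 w) /\
    ((forall n, cont_path (W n w) /\ W n w 0 = 0) /\ (forall n, 0 <= E n w))}.
  by apply: filterI => //; apply: filterI => //; exact: ae_foralln.
have {}HN w : ~ N w -> cont_path (A0 w) /\
    ((forall n, cont_path (W n w) /\ W n w 0 = 0) /\ (forall n, 0 <= E n w)).
  by move=> Nw; apply: contrapT => h; apply: Nw; exact: HN.
have [_ [N' [mN' PN' HN']] _] := HB.
have {}HN' w : ~ N' w -> cont_path (B w) /\ B w 0 = 0.
  by move=> Nw; apply: contrapT => h; apply: Nw; exact: HN'.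
have [pB _ _] := HB.
have pW n : is_process (W n) by have [] := HW n.
pose A0' := kill N A0; pose W' n := kill N (W n); pose B' := kill N' B.
pose E' n t : R := \1_(~` N) t * E n t.
have gA : good_proc A0' by apply: kill_good => // w /HN[].
have gW n : good_proc (W' n) by apply: kill_good => // w /HN[_ []].
have gB : good_proc B' by apply: kill_good.
have mE n : measurable_fun setT (E' n).
  apply: measurable_funM; last exact: (HE n).1.
  by apply: measurable_indic; exact: measurableC.
have EE n t : ~ N t -> E' n t = E n t.
  by move=> Nt; rewrite /E' indicE mem_set // mul1r.
have E0 n t : 0 <= E' n t.
  have [Nt|Nt] := pselect (N t); last by rewrite EE //; have [_ [_]] := HN t Nt.
  by rewrite /E' indicE memNset ?mul0r // => /(_ Nt).
have LW i M : grid_law P (hN M) (MN M) (fun j t => incr (hN M) (W' i t) j).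
  apply: kill_grid => //; first exact: hN_gt0.
  by move=> D mD; apply: std_BM_grid => //; exact: hN_gt0.
have LB M : grid_law P' (hN M) (MN M) (fun j t => incr (hN M) (B' t) j).
  apply: kill_grid => //; first exact: hN_gt0.
  by move=> D mD; apply: std_BM_grid => //; exact: hN_gt0.
have HI' n M : tandem_indep P (hN M) c0 n (MN M) (fun j t => incr (hN M) (W' 0%N t) j)
     (fun i j t => incr (hN M) (W' i.+1 t) j) (fun i => E' i.+1).
  have h0 : 0 < hN M :> R by exact: hN_gt0.
  move=> Ab Aw Ae mAb mAw mAe.
  rewrite -(data_indep c0 HW HE HI n (MN M) h0 mAb mAw mAe).
  have mi (X : T -> R -> R) j : is_process X -> measurable_fun setT (fun t => incr (hN M) (X t) j).
    by apply: measurable_incr; exact: ltW.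
  apply: (measure_eq_off_null mN PN).
  - apply: measurableI; first by apply: measurable_cyl => // j; apply: mi; exact: (gW 0%N).1.
    by apply: measurable_evt => // i j; apply: mi; exact: (gW i.+1).1.
  - apply: measurableI; first by apply: measurable_cyl => // j; exact: mi.
    by apply: measurable_evt => // [i j|i]; [exact: mi|exact: (HE i.+1).1].
  move=> t Nt; rewrite /cyl /evt /setI /= /W' kill_off //.
  split=> -[H1 H2]; split=> // i /H2; rewrite /cyl /= kill_off // EE //.
have := departures_cvg gA gW mE E0 gB HI' LW LB bf => H.
have [[M fM] _] := bf.
(* The original integrand is uncontrolled on [N], so the modification is undone with
   [eq_integral_null]. *)
have EX n : Epath P f (fun w t => Aproc c A0 W E n w t + Esum E n w) =
    (\int[P]_t f (layerT A0' W' E' c n t))%:E.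
  rewrite -(expect_fin P (bmfun_layerT gA gW mE E0 c n bf fM)) /Epath.
  apply: (eq_integral_null mN PN) => t Nt; congr (f _)%:E.
  apply/funext => s; rewrite Aproc_layer /layerT /A0' kill_off //.
  congr (layer _ _ _ _ _ _); apply/funext => i; first by rewrite /W' kill_off.
  by rewrite EE.
have bB : bmfun (fun t => f (B' t)) M.
  by apply: (@bmfun_layerT _ _ _ B' (fun=> B') (fun _ _ => 0) gB (fun=> gB) _ (fun _ _ => lexx 0) c 0%N).
have EB : Epath P' f B = (\int[P']_t f (B' t))%:E.
  rewrite -(expect_fin P' bB) /Epath; apply: (eq_integral_null mN' PN') => t Nt.
  by rewrite /B' kill_off.
rewrite EB (_ : (fun n => _) = (fun n => (\int[P]_t f (layerT A0' W' E' c n t))%:E)); last first.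
  by apply/funext => n; exact: EX.
by apply: cvg_EFin; [exact: nearW|exact: H].
Qed.
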